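(* Let $x$ be an irrational real number that is not noble. The $\mathrm{PGL}_2(\mathbb Z)$-orbit of $x$ is fixed by the involution induced by $\mathbf J_{\mathbb R}$ on orbits (that is, $\mathbf J_{\mathbb R}(x)=Mx$ for some $M\in\mathrm{PGL}_2(\mathbb Z)$) if and only if there is $M\in \mathrm{PGL}_2(\mathbb Z)$ such that $x$ is the point represented by the infinite periodic product $$(\mathbf J M)M(\mathbf J M)M(\mathbf J M)M\cdots,$$ i.e. such that $N=(\mathbf J M)M$ is hyperbolic and $x$ is the attracting fixed point of $N$ on $\widehat{\mathbb R}$.
   Context: Write $\widehat{\mathbb R}=\mathbb R\cup\{\infty\}$. $\mathrm{PGL}_2(\mathbb Z)$ (integral $2\times2$ matrices of determinant $\pm1$ modulo $\pm I$) acts on $\widehat{\mathbb R}$ by Möbius maps; an element is called hyperbolic here if it has exactly two fixed points in $\widehat{\mathbb R}$, one attracting and one repelling. The group is generated by $K:x\mapsto 1-x$, $U:x\mapsto 1/x$, $V:x\mapsto -x$, and Dyer's outer automorphism $\mathbf J$ is the automorphism with $V\mapsto UV$, $U\mapsto U$, $K\mapsto K$. Definition of $\mathbf J_{\mathbb R}$: An infinite binary string $a\in\{0,1\}^\omega$ is written $a=0^{n_0}1^{n_1}0^{n_2}1^{n_3}\cdots$ with $n_0\ge 0$ and $n_i\ge 1$ for $i\ge1$; if $a$ is eventually constant the list of exponents is finite and its last entry is $\infty$. Put $\kappa(a)=[n_0,n_1,n_2,\dots]=n_0+\cfrac1{n_1+\cfrac1{n_2+\cdots}}\in[0,\infty]$,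 with $1/\infty=0$ and $[\infty]=\infty$. This is a bijection from not-eventually-constant strings to positive irrationals. Let $\phi=(01)^\omega=0101\dots$, $\phi^*=(10)^\omega=1010\dots$, and let $\oplus$ be term-wise exclusive or. The map $\mathbf J_{\mathbb R}:\mathbb R\setminus\mathbb Q\to\widehat{\mathbb R}$ is: if $x>0$ is irrational and $x=\kappa(a)$, then $\mathbf J_{\mathbb R}(x)=\kappa(a\oplus\phi)$; if $x<0$ is irrational and $-1/x=\kappa(a)$, then $\mathbf J_{\mathbb R}(x)=-1/\kappa(a\oplus\phi^* )$ (with $1/0=\infty$, $1/\infty=0$). Noble numbers are the elements of the $\mathrm{PGL}_2(\mathbb Z)$-orbit of $\Phi=(1+\sqrt5)/2$. The moduli space of real rank-two lattices is $\widehat{\mathbb R}/\mathrm{PGL}_2(\mathbb Z)$. On irrational non-noble numbers $\mathbf J_{\mathbb R}$ satisfies $\mathbf J_{\mathbb R}(Mx)=(\mathbf JM)(\mathbf J_{\mathbb R}(x))$ for all $M\in\mathrm{PGL}_2(\mathbb Z)$, so it induces an involution on the set of their orbits. *)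

(* Defs.v *)
From HB Require Import structures.
From mathcomp Require Import all_boot all_order all_algebra.
From mathcomp Require Import all_classical all_reals all_analysis.
Set Implicit Arguments.
Unset Strict Implicit.
Unset Printing Implicit Defensive.
Import Order.TTheory GRing.Theory Num.Theory.
Import numFieldNormedType.Exports.
Local Open Scope classical_set_scope.
Local Open Scope ring_scope.

(** * The group PGL_2(Z) *)

(* Over int, [unitmx] says exactly that the determinant is 1 or -1. *)
Record GL2Z := MkGL2Z { gl2z_mx :> 'M[int]_2; gl2z_unit : gl2z_mx \in unitmx }.

HB.instance Definition _ := [isSub for gl2z_mx].
HB.instance Definition _ := [Choice of GL2Z by <:].

Definition gl2z_mul (A B : GL2Z) : GL2Z :=
  @MkGL2Z (gl2z_mx A *m gl2z_mx B)
    (etrans (unitmx_mul _ _) (introT andP (conj (gl2z_unit A) (gl2z_unit B)))).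
Definition gl2z_one : GL2Z := @MkGL2Z 1%:M (@unitmx1 int 2).
Definition gl2z_inv (A : GL2Z) : GL2Z :=
  @MkGL2Z (invmx A) (etrans (unitmx_inv _) (gl2z_unit A)).

Lemma gl2z_mulA : associative gl2z_mul.
Proof. by move=> A B C; apply: val_inj; rewrite /= mulmxA. Qed.
Lemma gl2z_mul1 : left_id gl2z_one gl2z_mul.
Proof. by move=> A; apply: val_inj; rewrite /= mul1mx. Qed.
Lemma gl2z_mulr1 : right_id gl2z_one gl2z_mul.
Proof. by move=> A; apply: val_inj; rewrite /= mulmx1. Qed.
Lemma gl2z_mulV : left_inverse gl2z_one gl2z_inv gl2z_mul.
Proof. by move=> A; apply: val_inj; rewrite /= mulVmx// gl2z_unit. Qed.
Lemma gl2z_mulrV : right_inverse gl2z_one gl2z_inv gl2z_mul.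
Proof. by move=> A; apply: val_inj; rewrite /= mulmxV// gl2z_unit. Qed.

HB.instance Definition _ :=
  isGroup.Build GL2Z gl2z_mulA gl2z_mul1 gl2z_mulr1 gl2z_mulV gl2z_mulrV.

Definition eq_upto_sign (A B : GL2Z) : bool :=
  (gl2z_mx A == gl2z_mx B) || (gl2z_mx A == - gl2z_mx B).

Lemma eq_upto_sign_refl : reflexive eq_upto_sign.
Proof. by move=> A; rewrite /eq_upto_sign eqxx. Qed.
Lemma eq_upto_sign_sym : symmetric eq_upto_sign.
Proof.
by move=> A B; rewrite /eq_upto_sign eq_sym -eqr_oppLR [- _ == _]eq_sym.
Qed.
Lemma eq_upto_sign_trans : transitive eq_upto_sign.
Proof.
move=> B A C; rewrite /eq_upto_sign => /orP[]/eqP-> /orP[]/eqP->;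
  by rewrite ?opprK eqxx ?orbT.
Qed.

Canonical eq_upto_sign_equiv :=
  EquivRel eq_upto_sign eq_upto_sign_refl eq_upto_sign_sym eq_upto_sign_trans.

Local Open Scope quotient_scope.

Definition PGL2Z := {eq_quot eq_upto_sign}.
HB.instance Definition _ := Choice.on PGL2Z.
HB.instance Definition _ := EqQuotient.on PGL2Z.

Definition pgl2z_mul (g h : PGL2Z) : PGL2Z := \pi_PGL2Z (repr g * repr h)%g.
Definition pgl2z_one : PGL2Z := \pi_PGL2Z 1%g.
Definition pgl2z_inv (g : PGL2Z) : PGL2Z := \pi_PGL2Z (repr g)^-1%g.

Lemma repr_piP (A : GL2Z) : eq_upto_sign (repr (\pi_PGL2Z A)) A.
Proof. by apply/eqmodP; rewrite reprK. Qed.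

Lemma pgl2z_mul_pi (A B : GL2Z) :
  pgl2z_mul (\pi A) (\pi B) = \pi_PGL2Z (A * B)%g.
Proof.
apply/eqmodP; rewrite /= /eq_upto_sign /=.
case/orP: (repr_piP A) => /eqP->; case/orP: (repr_piP B) => /eqP->;
  by rewrite ?mulmxN ?mulNmx ?opprK eqxx ?orbT.
Qed.

Lemma pgl2z_mulA : associative pgl2z_mul.
Proof.
by move=> g h k; rewrite -[g]reprK -[h]reprK -[k]reprK !pgl2z_mul_pi mulgA.
Qed.
Lemma pgl2z_mul1 : left_id pgl2z_one pgl2z_mul.
Proof. by move=> g; rewrite -[g]reprK pgl2z_mul_pi mul1g. Qed.
Lemma pgl2z_mulr1 : right_id pgl2z_one pgl2z_mul.
Proof. by move=> g; rewrite -[g]reprK pgl2z_mul_pi mulg1. Qed.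
Lemma pgl2z_mulV : left_inverse pgl2z_one pgl2z_inv pgl2z_mul.
Proof. by move=> g; rewrite -{2}[g]reprK pgl2z_mul_pi mulVg. Qed.
Lemma pgl2z_mulrV : right_inverse pgl2z_one pgl2z_inv pgl2z_mul.
Proof. by move=> g; rewrite -{1}[g]reprK pgl2z_mul_pi mulgV. Qed.

HB.instance Definition _ :=
  isGroup.Build PGL2Z pgl2z_mulA pgl2z_mul1 pgl2z_mulr1 pgl2z_mulV pgl2z_mulrV.

Definition mx2 (a b c d : int) : 'M[int]_2 :=
  \matrix_(i < 2, j < 2)
    if i == 0 then (if j == 0 then a else b) else (if j == 0 then c else d).

Lemma unitmx_mx2 (a b c d : int) :
  a * d - b * c \is a GRing.unit -> mx2 a b c d \in unitmx.
Proof.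
rewrite unitmxE (expand_det_row _ ord0) !big_ord_recl big_ord0 /cofactor.
by rewrite !det_mx11 !mxE /= addr0 expr0 expr1 mul1r mulN1r mulrN.
Qed.

(* K : x |-> 1 - x,  U : x |-> 1 / x,  V : x |-> - x *)
Definition pglK : PGL2Z :=
  \pi_PGL2Z (@MkGL2Z (mx2 (-1) 1 0 1) (@unitmx_mx2 (-1) 1 0 1 isT)).
Definition pglU : PGL2Z :=
  \pi_PGL2Z (@MkGL2Z (mx2 0 1 1 0) (@unitmx_mx2 0 1 1 0 isT)).
Definition pglV : PGL2Z :=
  \pi_PGL2Z (@MkGL2Z (mx2 (-1) 0 0 1) (@unitmx_mx2 (-1) 0 0 1 isT)).

(* Exactly one J has this property: it exists by Dyer's theorem, and it is
   unique because K, U and V generate the group. *)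
Definition dyer_automorphism (J : PGL2Z -> PGL2Z) : Prop :=
  [/\ bijective J, {morph J : g h / (g * h)%g},
      J pglV = (pglU * pglV)%g, J pglU = pglU & J pglK = pglK].

(** * The projective line R u {oo} and its Moebius maps *)

(* [Some x] is the real number x and [None] is the point oo. *)
Notation Rhat R := (one_point_compactification R).

Section ProjectiveLine.
Variable R : realType.
Implicit Types (x : R) (y p q : Rhat R) (g : PGL2Z).

Definition moebius (A : 'M[int]_2) y : Rhat R :=
  match y with
  | Some x =>
      let den := (A 1 0)%:~R * x + (A 1 1)%:~R in
      if den == 0 then None else Some (((A 0 0)%:~R * x + (A 0 1)%:~R) / den)
  | None =>
      if A 1 0 == 0 then None else Some ((A 0 0)%:~R / (A 1 0)%:~R)
  end.

Lemma moebiusN (A : 'M[int]_2) y : moebius (- A) y = moebius A y.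
Proof.
case: y => [x|]; rewrite /moebius !mxE ?oppr_eq0 !rmorphN /=.
  by rewrite !mulNr -!opprD oppr_eq0 invrN mulrNN.
by rewrite invrN mulrNN.
Qed.

Definition act g y : Rhat R := moebius (repr g) y.

Lemma act_pi (A : GL2Z) y : act (\pi A) y = moebius A y.
Proof. by rewrite /act; case/orP: (repr_piP A) => /eqP->; rewrite ?moebiusN. Qed.

Definition fixed_point g p : Prop := act g p = p.

Definition attracting g p : Prop :=
  fixed_point g p /\
  \forall y \near p, iter n (act g) y @[n --> \oo] --> p.

Definition repelling g p : Prop := attracting g^-1%g p.

Definition hyperbolic g : Prop :=
  exists p q, [/\ p <> q, forall y, fixed_point g y <-> y = p \/ y = q,
                  attracting g p & repelling g q].

Definition noble y : Prop :=
  exists g, y = act g (Some ((1 + Num.sqrt 5) / 2)).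

Definition hat_inv y : Rhat R :=
  match y with
  | Some x => if x == 0 then None else Some x^-1
  | None => Some 0
  end.

Definition hat_opp y : Rhat R := omap -%R y.

(** * Binary strings and continued fractions *)

(* The letter 0 is [false], the letter 1 is [true]. *)
Definition bstring := nat -> bool.

(* The length of the longest prefix of a of the form b b b ...; the value
   [None] stands for an infinite length. *)
Definition run_length (b : bool) (a : bstring) : option nat :=
  if pselect (exists n, a n != b) is left ex then Some (ex_minn ex) else None.

(* Once an exponent is infinite, so are all the following ones: the list
   n_0, ..., n_{k-1}, oo of an eventually constant string is padded by oo. *)
Fixpoint exponents_from (b : bool) (a : bstring) (i : nat) : option nat :=
  match i, run_length b a with
  | 0, r => r
  | i'.+1, Some n => exponents_from (~~ b) (fun k => a (n + k)%N) i'
  | _.+1, None => None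
  end.

Definition exponents (a : bstring) : nat -> option nat :=
  exponents_from false a.

Definition hat_addn (n : option nat) y : Rhat R :=
  match n, y with
  | Some k, Some x => Some (k%:R + x)
  | _, _ => None
  end.

(* The value oo at the empty list gives [n] = n + 1/oo = n.  Entries after
   an infinite one have no effect on the value. *)
Fixpoint cfrac (s : seq (option nat)) : Rhat R :=
  if s is n :: s' then hat_addn n (hat_inv (cfrac s')) else None.

(* For an eventually constant string, the sequence of convergents is
   eventually constant, equal to the value of the finite continued fraction. *)
Definition kappa (a : bstring) : Rhat R :=
  lim (cfrac (mkseq (exponents a) k) @[k --> \oo]).

Definition phi : bstring := odd.
Definition phi_star : bstring := fun n => ~~ odd n.
Definition bxor (a b : bstring) : bstring := fun n => a n (+) b n.

(* The string a with kappa a = x, for a positive irrational x; the value at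
   any other x is irrelevant. *)
Definition kappa_inv x : bstring := xget phi [set a | kappa a = Some x].

(* Only meaningful at irrational numbers. *)
Definition JR x : Rhat R :=
  if 0 < x then kappa (bxor (kappa_inv x) phi)
  else hat_opp (hat_inv (kappa (bxor (kappa_inv (- x^-1)) phi_star))).

End ProjectiveLine.

(* Main.v *)
Require Import Defs.
From HB Require Import structures.
From mathcomp Require Import all_boot all_order all_algebra.
From mathcomp Require Import all_classical all_reals all_analysis.
From mathcomp Require Import ring lra zify.
Import Order.TTheory GRing.Theory Num.Theory.
Import numFieldNormedType.Exports.
Set Implicit Arguments.
Unset Strict Implicit.
Unset Printing Implicit Defensive.
Local Open Scope classical_set_scope.
Local Open Scope ring_scope.

(** The key is that Dyer's automorphism is the bitwise exclusive or with
    0101... at the level of words. Let the letter 0 be x |-> x + 1 and the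
    letter 1 be x |-> x / (x + 1). A positive irrational x is represented by the
    infinite product of the letters of its string a, and J maps each letter to
    itself followed by U ([dyer_letter]). As U complements the letters to its right,
    J sends the product of the first n letters of a to the product of the first n
    letters of a + phi, times U if n is odd ([dyer_prefix]).

    Let x be the value of a and y = J_R(x) that of a + phi. Non-noble means that
    a + phi is not eventually constant ([not_noble_mixed]), so y is irrational.
    Every element of PGL_2(Z) that maps the value of a string to the value of
    another one replaces a prefix of length m by a prefix of length n, with a
    possible complement of the common tail ([serret]). Applying J to such an element
    replaces the prefixes by those of the strings shifted by phi, with the same m
    and n ([dyer_equivariant]); this is the equivariance of J_R.

    Attraction is measured by the growth of the l1 norm of the vector (x, 1). It is
    preserved by U and increased by each letter, so an element that fixes x and
    replaces a prefix of length m by one of length n has an eigenvalue of modulus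
    above 1 at x if and only if m < n ([prefix_stretch_ratio]). For a fixed
    irrational, this is the same as being the attracting fixed point of a hyperbolic
    element ([expanding_hyperbolic], [attracting_expanding]).

    Suppose that y = M x. Then N = (J M) M fixes x, and M has m <> n: otherwise a
    tail of a would agree with itself plus a tail of phi, up to complement. Both M
    and J M change the prefix lengths in the same direction, so x is attracting for
    N if m < n, and for the inverse of N if n < m; the latter is the element
    attached to the inverse of J M, as J is an involution. Conversely, suppose that
    x is attracting for N = (J M) M. By equivariance y is fixed by J N = M (J M),
    with the same prefix lengths as N, hence attracting; but so is M x, because J N
    is the conjugate of N by M. Hence y = M x. *)

(** * Generation of PGL_2(Z) *)

Lemma mx2E (A : 'M[int]_2) : A = mx2 (A 0 0) (A 0 1) (A 1 0) (A 1 1).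
Proof.
apply/matrixP => i j; rewrite mxE.
by case: i j => [[|[|//]] hi] [[|[|//]] hj] /=; congr (A _ _); apply: val_inj.
Qed.

Lemma mul_mx2 (a b c d a' b' c' d' : int) :
  mx2 a b c d *m mx2 a' b' c' d' =
  mx2 (a * a' + b * c') (a * b' + b * d') (c * a' + d * c') (c * b' + d * d').
Proof.
rewrite [LHS]mx2E !mxE !big_ord_recl !big_ord0 !mxE /=.
by rewrite !addr0.
Qed.

Lemma opp_mx2 (a b c d : int) : - mx2 a b c d = mx2 (- a) (- b) (- c) (- d).
Proof. by rewrite [LHS]mx2E !mxE /=. Qed.

Lemma unit_mx2E (A : 'M[int]_2) :
  (A \in unitmx) = (A 0 0 * A 1 1 - A 0 1 * A 1 0 \is a GRing.unit).
Proof.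
rewrite unitmxE (expand_det_row _ ord0) !big_ord_recl big_ord0 /cofactor.
rewrite !det_mx11 !mxE /= addr0 expr0 expr1 mul1r mulN1r mulrN.
by congr (_ * A _ _ - A _ _ * A _ _ \is a GRing.unit); apply: val_inj.
Qed.

Lemma pgl_mx2_ind (P : PGL2Z -> Prop) :
  (forall a b c d (h : mx2 a b c d \in unitmx), P (\pi_PGL2Z (MkGL2Z h))%qT) ->
  forall g, P g.
Proof.
move=> hP g; rewrite -[g]reprK; case: (repr g) => A hA.
have e := mx2E A; have hA' := hA; rewrite e in hA'.
rewrite (_ : MkGL2Z hA = MkGL2Z hA') //; exact: val_inj.
Qed.

Lemma pgl1E : 1%g = (\pi_PGL2Z (1%g : GL2Z))%qT :> PGL2Z.
Proof. by []. Qed.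

Lemma pglME (A B : GL2Z) :
  ((\pi_PGL2Z A : PGL2Z) * \pi_PGL2Z B = \pi_PGL2Z (A * B)%g)%g%qT.
Proof. exact: pgl2z_mul_pi. Qed.

Lemma pgl_eq (A B : GL2Z) : eq_upto_sign A B -> (\pi_PGL2Z A = \pi_PGL2Z B)%qT.
Proof. by move=> e; apply/eqmodP. Qed.

Lemma one_mx2 : 1%:M = mx2 1 0 0 1.
Proof. by rewrite [LHS]mx2E !mxE. Qed.

Lemma pglUU : (pglU * pglU = 1)%g.
Proof.
rewrite /pglU pglME pgl1E; apply: pgl_eq.
by rewrite /eq_upto_sign /= mul_mx2 one_mx2 eqxx.
Qed.

Lemma pglVV : (pglV * pglV = 1)%g.
Proof.
rewrite /pglV pglME pgl1E; apply: pgl_eq.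
by rewrite /eq_upto_sign /= mul_mx2 one_mx2 eqxx.
Qed.

Lemma pglKK : (pglK * pglK = 1)%g.
Proof.
rewrite /pglK pglME pgl1E; apply: pgl_eq.
by rewrite /eq_upto_sign /= mul_mx2 one_mx2 eqxx.
Qed.

Lemma pglUV : (pglU * pglV = pglV * pglU)%g.
Proof.
rewrite /pglU /pglV !pglME; apply: pgl_eq.
by apply/orP; right; apply/eqP; rewrite /= !mul_mx2 opp_mx2.
Qed.

(** As K and U are involutions, this is the relation (KU)^3 = 1. *)
Lemma pglKUK : (pglK * pglU * pglK = pglU * pglK * pglU)%g.
Proof.
rewrite /pglU /pglK !pglME; apply: pgl_eq.
by apply/orP; right; apply/eqP; rewrite /= !mul_mx2 opp_mx2.
Qed.

Lemma pglUUK g : (pglU * (pglU * g) = g)%g.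
Proof. by rewrite mulgA pglUU mul1g. Qed.

Lemma pglKKK g : (pglK * (pglK * g) = g)%g.
Proof. by rewrite mulgA pglKK mul1g. Qed.

Fact unitmx_translation (k : int) : mx2 1 k 0 1 \in unitmx.
Proof. by rewrite unit_mx2E !mxE /= mulr0 subr0. Qed.

Definition translation k : PGL2Z :=
  (\pi_PGL2Z (MkGL2Z (unitmx_translation k)))%qT.

Lemma translationS k : translation (1 + k) = (pglK * pglV * translation k)%g.
Proof.
rewrite /translation /pglV /pglK !pglME; apply: pgl_eq.
apply/orP; left; apply/eqP; rewrite /= !mul_mx2; congr mx2; ring.
Qed.

Lemma translationN k : translation (- k) = (pglV * translation k * pglV)%g.
Proof.
rewrite /translation /pglV !pglME; apply: pgl_eq.
apply/orP; left; apply/eqP; rewrite /= !mul_mx2; congr mx2; ring.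
Qed.

(** The generators suffice by Euclid's algorithm on the first column: the
    translations, which are the powers of KV, reduce its upper entry modulo the
    lower one, and U exchanges both. When the lower entry vanishes, a translation
    is left, up to V. *)
Lemma pgl_ind (P : PGL2Z -> Prop) :
  P 1%g ->
  (forall g, P g -> P (pglU * g)%g) -> (forall g, P g -> P (pglV * g)%g) ->
  (forall g, P g -> P (pglK * g)%g) -> forall g, P g.
Proof.
move=> P1 PU PV PK.
have Ptr k g : P g -> P (translation k * g)%g.
  move=> Pg; have Pn (n : nat) h : P h -> P (translation n%:Z * h)%g.
    move=> Ph; elim: n => [|n IHn].
      suff -> : translation 0%:Z = 1%g by rewrite mul1g.
      by rewrite pgl1E; apply: pgl_eq; rewrite /eq_upto_sign /= one_mx2 eqxx.
    by rewrite intS translationS -!mulgA; apply/PK/PV.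
  case: (lerP 0 k) => hk; first by rewrite -(gez0_abs hk); exact: Pn.
  rewrite -[k]opprK -(ltz0_abs hk) translationN -!mulgA.
  by apply/PV/Pn/PV.
apply: pgl_mx2_ind => a b c d; have [n] := ubnP `|c|%N.
elim: n a b c d => // n IH a b c d cn h.
have det : a * d - b * c \is a GRing.unit by have := h; rewrite unit_mx2E !mxE.
have [c0|c0] := eqVneq c 0; last first.
  pose q := divz a c.
  have h' : mx2 c d (a - q * c) (b - q * d) \in unitmx.
    rewrite unit_mx2E !mxE /= -unitrN.
    suff -> : - (c * (b - q * d) - d * (a - q * c)) = a * d - b * c by [].
    ring.
  suff -> : (\pi_PGL2Z (MkGL2Z h) = translation q * (pglU * \pi_PGL2Z (MkGL2Z h')))%g%qT.
    apply/Ptr/PU/IH; rewrite /q {1}(divz_eq a c) addrAC subrr add0r.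
    by have := modz_ge0 a c0; have := ltz_mod a c0; lia.
  rewrite /translation /pglU !pglME; apply: pgl_eq; apply/orP; left; apply/eqP.
  by rewrite /= !mul_mx2; congr mx2; ring.
move: det h; rewrite {}c0 mulr0 subr0 unitrM => /andP[ua ud] h {cn}.
have dd : d * d = 1 by move: ud; rewrite qualifE /=; lia.
have [aE|aE] : a * d = 1 \/ a * d = -1.
- by move: ua ud; rewrite !qualifE /=; lia.
- suff -> : (\pi_PGL2Z (MkGL2Z h) = translation (b * d) * 1)%g%qT by exact: Ptr.
  rewrite mulg1; apply: pgl_eq; rewrite /eq_upto_sign /=.
  have [dE|dE] : d = 1 \/ d = -1 by lia.
    by apply/orP; left; apply/eqP; congr mx2; lia.
  by apply/orP; right; apply/eqP; rewrite opp_mx2; congr mx2; lia.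
- suff -> : (\pi_PGL2Z (MkGL2Z h) = translation (b * d) * (pglV * 1))%g%qT.
    exact/Ptr/PV.
  rewrite mulg1 /translation /pglV pglME; apply: pgl_eq; rewrite /eq_upto_sign /= mul_mx2.
  have [dE|dE] : d = 1 \/ d = -1 by lia.
    by apply/orP; left; apply/eqP; congr mx2; lia.
  by apply/orP; right; apply/eqP; rewrite opp_mx2; congr mx2; lia.
Qed.

(** * Words in two letters and Dyer's automorphism *)

Definition flip (e : bool) : PGL2Z := if e then pglU else 1%g.
Definition mirror (v : bool) : PGL2Z := if v then pglV else 1%g.

(** The letter 0 is KV, that is x |-> x + 1, and the letter 1 is its conjugate
    x |-> x / (x + 1) by U. A string a thus represents the limit of the products
    of its letters, which is the continued fraction of its run lengths. *)
Definition letter (b : bool) : PGL2Z :=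
  (flip b * (pglK * pglV) * flip b)%g.

Lemma letter0 : letter false = (pglK * pglV)%g.
Proof. by rewrite /letter mul1g mulg1. Qed.

Definition word (q : seq bool) : PGL2Z :=
  foldr (fun b g => letter b * g)%g 1%g q.

Lemma word_cat q r : word (q ++ r) = (word q * word r)%g.
Proof. by elim: q => [|b q IH] /=; rewrite ?mul1g// IH mulgA. Qed.

Lemma word_rcons q b : word (rcons q b) = (word q * letter b)%g.
Proof. by rewrite -cats1 word_cat /= mulg1. Qed.

Lemma flipM e f : (flip e * flip f)%g = flip (e (+) f).
Proof. by case: e f => -[] /=; rewrite ?pglUU ?mul1g ?mulg1. Qed.

Lemma flip_letter e b : (flip e * letter b)%g = (letter (b (+) e) * flip e)%g.
Proof.
by rewrite /letter mulgA mulgA flipM -[RHS]mulgA flipM (addbC e b) addbK.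
Qed.

Lemma flip_word e q :
  (flip e * word q)%g = (word (map (addb^~ e) q) * flip e)%g.
Proof.
elim: q => [|b q IH] /=; first by rewrite mul1g mulg1.
by rewrite mulgA flip_letter -mulgA IH mulgA.
Qed.

(** The identity 1 - x / (x + 1) = 1 / (x + 1). *)
Lemma K_letter1 : (pglK * letter true = letter true * pglU)%g.
Proof.
rewrite /letter /= !mulgA pglKUK -!mulgA; congr (_ * (_ * _))%g.
by rewrite pglUU mulg1 -pglUV pglUUK.
Qed.

(** Induction on g. Left multiplication by U complements the letters of q and
    comes out on the right; V changes the sign. If the sign is there, K turns it
    into a letter 0. Otherwise K cancels a first letter 0, leaving a sign, and
    passes through a first letter 1 as U. When q is empty, the next letter of a
    is used up to provide a first letter. *)
Lemma straighten g (a : bstring) : exists m v q e,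
  (g * word (mkseq a m) = mirror v * word q * flip e)%g.
Proof.
elim/pgl_ind: g => [|g [m [v [q [e IH]]]]|g [m [v [q [e IH]]]]|
  g [m [v [q [e IH]]]]].
- by exists 0, false, [::], false; rewrite /= !mul1g.
- exists m, v, (map (addb^~ true) q), (true (+) e).
  rewrite -mulgA IH -flipM !mulgA; congr (_ * _)%g.
  rewrite -[RHS]mulgA -flip_word /= mulgA; congr (_ * _)%g.
  by case: (v); rewrite /= ?mulg1 ?mul1g // pglUV.
- exists m, (~~ v), q, e; rewrite -mulgA IH !mulgA; congr (_ * _ * _)%g.
  by case: (v) => /=; rewrite ?mulg1 // pglVV.
case: v IH => /= IH.
  exists m, false, (false :: q), e; rewrite -mulgA IH.
  by rewrite /= letter0 mul1g !mulgA.
have {m q IH} [m [b [q /= IH]]] : exists m b q,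
    (g * word (mkseq a m))%g = (word (b :: q) * flip e)%g.
  case: q IH => [|b q] IH; last by exists m, b, q; rewrite IH mul1g.
  exists m.+1, (a m (+) e), [::]; rewrite mkseqS word_rcons mulgA IH /=.
  by rewrite !mul1g mulg1 flip_letter.
case: b IH => IH.
  exists m, false, (true :: map (addb^~ true) q), (true (+) e).
  rewrite -mulgA IH mul1g -flipM /= mulgA [(pglK * _)%g]mulgA K_letter1.
  rewrite -[(letter true * pglU * _)%g]mulgA [(pglU * word q)%g](flip_word true).
  by rewrite [in RHS]mulgA -[in RHS](mulgA (letter true)).
exists m, true, q, e; rewrite -mulgA IH letter0.
by rewrite -!mulgA pglKKK.
Qed.

Section Dyer.
Variables (J : PGL2Z -> PGL2Z) (hJ : dyer_automorphism J).

Lemma dyerM g h : J (g * h)%g = (J g * J h)%g.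
Proof. by case: hJ. Qed.

Lemma dyer1 : J 1%g = 1%g.
Proof. by apply: (mulgI (J 1%g)); rewrite -dyerM !mulg1. Qed.

Lemma dyerV g : J g^-1%g = (J g)^-1%g.
Proof. by apply: (mulgI (J g)); rewrite -dyerM !mulgV dyer1. Qed.

Lemma dyer_flip e : J (flip e) = flip e.
Proof. by case: hJ => _ _ _ JU _; case: e; rewrite ?dyer1. Qed.

Lemma dyerK g : J (J g) = g.
Proof.
case: hJ => _ _ JV JU JK.
elim/pgl_ind: g => [|g IH|g IH|g IH]; rewrite ?dyer1// !dyerM IH.
- by rewrite !JU.
- by rewrite JV dyerM JU JV pglUUK.
- by rewrite !JK.
Qed.

(** As J(KV) = KUV = (KV)U. *)
Lemma dyer_letter b : J (letter b) = (letter b * pglU)%g.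
Proof.
case: hJ => _ _ JV JU JK.
rewrite /letter !dyerM dyer_flip JK JV pglUV -!mulgA.
by case: b => /=; rewrite ?mulg1 ?mul1g ?pglUU.
Qed.

(** Each letter produces one more U; moving these to the right complements
    every second letter, which is the effect of phi. *)
Lemma dyer_prefix (a : bstring) n :
  J (word (mkseq a n)) = (word (mkseq (bxor a phi) n) * flip (odd n))%g.
Proof.
elim: n => [|n IH]; first by rewrite /= dyer1 mul1g.
have step : (flip (odd n) * (letter (a n) * pglU) =
             letter (bxor a phi n) * flip (odd n.+1))%g.
  rewrite mulgA flip_letter -[LHS]mulgA -/(flip true) flipM addbT.
  by [].
by rewrite !mkseqS !word_rcons dyerM IH dyer_letter -[LHS]mulgA step mulgA.
Qed.

End Dyer.

(** * The action on irrational numbers *)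

Section RealAction.
Variable R : realType.
Implicit Types (x y z : R) (A B : 'M[int]_2) (g h : PGL2Z).

Lemma irrational_affine x (p q : rat) : irrational x ->
  ratr p * x + ratr q = 0 -> p = 0 /\ q = 0.
Proof.
move=> xirr e; have [p0|p0] := eqVneq p 0.
  split=> //; move: e; rewrite p0 rmorph0 mul0r add0r => /eqP.
  by rewrite fmorph_eq0 => /eqP.
exfalso; apply: xirr; exists (- q / p) => //=.
rewrite rmorphM/= rmorphN/= fmorphV/=.
have p0' : ratr p != 0 :> R by rewrite fmorph_eq0.
by apply: (mulIf p0'); rewrite mulfVK// mulrC; apply/eqP; rewrite eq_sym -addr_eq0; apply/eqP.
Qed.

Lemma irrational_affinez x (p q : int) : irrational x ->
  p%:~R * x + q%:~R = 0 -> p = 0 /\ q = 0.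
Proof.
move=> xirr e; have [||/eqP + /eqP] := @irrational_affine x p%:~R q%:~R => //.
  by rewrite !ratr_int.
by rewrite !intr_eq0 => /eqP -> /eqP ->.
Qed.

Definition numer A x : R := (A 0 0)%:~R * x + (A 0 1)%:~R.
Definition denom A x : R := (A 1 0)%:~R * x + (A 1 1)%:~R.

Definition ract g x : R := numer (repr g) x / denom (repr g) x.

(** The factor by which g multiplies the l1 norm of the vector (x, 1). At a
    fixed point it is the modulus of the eigenvalue, so that it decides between
    attracting and repelling; the l1 norm is chosen because U preserves it and
    every letter increases it. *)
Definition stretch g x : R :=
  (`|numer (repr g) x| + `|denom (repr g) x|) / (`|x| + 1).

Lemma numerN A x : numer (- A) x = - numer A x.
Proof. by rewrite /numer !mxE !rmorphN/= mulNr opprD. Qed.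

Lemma denomN A x : denom (- A) x = - denom A x.
Proof. by rewrite /denom !mxE !rmorphN/= mulNr opprD. Qed.

Lemma ract_pi (A : GL2Z) x :
  ract (\pi_PGL2Z A)%qT x = numer (gl2z_mx A) x / denom (gl2z_mx A) x.
Proof.
rewrite /ract; case/orP: (repr_piP A) => /eqP-> //.
by rewrite numerN denomN invrN mulrNN.
Qed.

Lemma stretch_pi (A : GL2Z) x : stretch (\pi_PGL2Z A)%qT x =
  (`|numer (gl2z_mx A) x| + `|denom (gl2z_mx A) x|) / (`|x| + 1).
Proof.
rewrite /stretch; case/orP: (repr_piP A) => /eqP-> //.
by rewrite numerN denomN !normrN.
Qed.

Lemma det_GL2Z (A : GL2Z) :
  gl2z_mx A 0 0 * gl2z_mx A 1 1 - gl2z_mx A 0 1 * gl2z_mx A 1 0 = 1 \/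
  gl2z_mx A 0 0 * gl2z_mx A 1 1 - gl2z_mx A 0 1 * gl2z_mx A 1 0 = -1.
Proof.
have := gl2z_unit A; rewrite unit_mx2E qualifE /= => /orP[]/eqP; auto.
Qed.

Lemma denom_neq0 (A : GL2Z) x : irrational x -> denom (gl2z_mx A) x != 0.
Proof.
move=> xirr; apply/eqP => /(irrational_affinez xirr)[c0 d0].
by have := det_GL2Z A; rewrite c0 d0 !mulr0 subr0 => -[].
Qed.

Lemma act_irr g x : irrational x -> act g (Some x : Rhat R) = Some (ract g x).
Proof.
by move=> xirr; rewrite /act /= (negPf (denom_neq0 (repr g) xirr)).
Qed.

Lemma irrational_ract g x : irrational x -> irrational (ract g x).
Proof.
move=> xirr [q _]; rewrite /ract; set A := repr g => e.
have d0 := denom_neq0 A xirr.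
have : ratr ((gl2z_mx A 0 0)%:~R - q * (gl2z_mx A 1 0)%:~R) * x +
       ratr ((gl2z_mx A 0 1)%:~R - q * (gl2z_mx A 1 1)%:~R) = 0.
  have : numer A x = ratr q * denom A x by rewrite e mulfVK.
  rewrite !rmorphB !rmorphM/= !ratr_int /numer /denom => e'.
  rewrite mulrBl addrACA e'; ring.
move=> /(irrational_affine xirr)[/eqP + /eqP].
rewrite !subr_eq0 => /eqP e1 /eqP e2.
have : ((gl2z_mx A 0 0 * gl2z_mx A 1 1 - gl2z_mx A 0 1 * gl2z_mx A 1 0)%:~R = 0 :> rat).
  rewrite rmorphB !rmorphM /= e1 e2; ring.
by move/eqP; rewrite intr_eq0 => /eqP D0; case: (det_GL2Z A); rewrite D0.
Qed.

Lemma numerM A B x : denom B x != 0 ->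
  numer (A *m B) x = numer A (numer B x / denom B x) * denom B x.
Proof.
move=> d0; rewrite {1 2}/numer mulrDl mulrA mulfVK // !mxE !big_ord_recl !big_ord0.
rewrite /numer /denom !addr0 !rmorphD !rmorphM /=.
have -> : lift ord0 ord0 = 1 :> 'I_2 by apply: val_inj.
ring.
Qed.

Lemma denomM A B x : denom B x != 0 ->
  denom (A *m B) x = denom A (numer B x / denom B x) * denom B x.
Proof.
move=> d0; rewrite {1 2}/denom mulrDl mulrA mulfVK // !mxE !big_ord_recl !big_ord0.
rewrite /numer /denom !addr0 !rmorphD !rmorphM /=.
have -> : lift ord0 ord0 = 1 :> 'I_2 by apply: val_inj.
ring.
Qed.

Lemma ractM g h x : irrational x -> ract (g * h)%g x = ract g (ract h x).
Proof.
move=> xirr; have d0 := denom_neq0 (repr h) xirr.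
rewrite [LHS](ract_pi (repr g * repr h)%g) /= numerM// denomM//.
by rewrite -mulf_div divff // mulr1.
Qed.

Lemma norm1_gt0 x : 0 < `|x| + 1.
Proof. by rewrite ltr_wpDl. Qed.

Lemma stretchM g h x : irrational x ->
  stretch (g * h)%g x = stretch g (ract h x) * stretch h x.
Proof.
move=> xirr; have d0 := denom_neq0 (repr h) xirr.
rewrite [LHS](stretch_pi (repr g * repr h)%g) /= numerM// denomM//.
rewrite -/(ract h x).
have : `|numer (repr h) x| = `|ract h x| * `|denom (repr h) x|.
  by rewrite -normrM /ract mulfVK.
move: (ract h x) => r e; rewrite /stretch e !normrM.
by field; rewrite !gt_eqF ?norm1_gt0.
Qed.

Lemma ract1 x : ract 1%g x = x.
Proof.
rewrite pgl1E ract_pi /numer /denom /= one_mx2 !mxE /=.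
by rewrite mul0r mul1r add0r addr0 divr1.
Qed.

Lemma stretch1 x : stretch 1%g x = 1.
Proof.
rewrite pgl1E stretch_pi /numer /denom /= one_mx2 !mxE /=.
by rewrite mul0r mul1r add0r addr0 normr1 divff // gt_eqF ?norm1_gt0.
Qed.

Lemma stretch_gt0 g x : irrational x -> 0 < stretch g x.
Proof.
move=> xirr; rewrite divr_gt0 ?norm1_gt0// ltr_wpDl// normr_gt0.
exact: denom_neq0.
Qed.

Lemma stretch_fixed g x : irrational x -> ract g x = x ->
  stretch g x = `|denom (repr g) x|.
Proof.
move=> xirr gx; have d0 := denom_neq0 (repr g) xirr.
have e : numer (repr g) x = x * denom (repr g) x.
  by rewrite -[X in X * _]gx mulfVK.
by rewrite /stretch e normrM; field; rewrite gt_eqF ?norm1_gt0.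
Qed.

Lemma ractK g x : irrational x -> ract g^-1%g (ract g x) = x.
Proof. by move=> xirr; rewrite -ractM// mulVg ract1. Qed.

Lemma stretchV g x : irrational x -> stretch g^-1%g (ract g x) = (stretch g x)^-1.
Proof.
move=> xirr; have s0 := stretch_gt0 g xirr.
by apply: (mulIf (lt0r_neq0 s0)); rewrite -stretchM// mulVg stretch1 mulVf ?gt_eqF.
Qed.

(** The two fixed points of g carry the two eigenvalues, whose product is 1
    or -1: only one of them is larger than 1 in modulus. *)
Lemma expanding_fixed_uniq g y z : irrational y -> irrational z ->
  ract g y = y -> ract g z = z -> 1 < stretch g y -> 1 < stretch g z -> y = z.
Proof.
move=> yirr zirr gy gz; rewrite !stretch_fixed// => sy sz.
apply/eqP; apply: contraT => yz.
have ey : numer (repr g) y = y * denom (repr g) y.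
  by rewrite -[X in X * _]gy mulfVK// denom_neq0.
have ez : numer (repr g) z = z * denom (repr g) z.
  by rewrite -[X in X * _]gz mulfVK// denom_neq0.
have : 1 < `|denom (repr g) y * denom (repr g) z| by rewrite normrM mulr_egt1.
suff -> : denom (repr g) y * denom (repr g) z =
    (gl2z_mx (repr g) 0 0 * gl2z_mx (repr g) 1 1
     - gl2z_mx (repr g) 0 1 * gl2z_mx (repr g) 1 0)%:~R.
  by case: (det_GL2Z (repr g)) => ->; rewrite ?rmorphN1 ?normrN normr1 ltxx.
move: ey ez; rewrite /numer /denom rmorphB !rmorphM /=.
set a := (_ 0 0)%:~R; set b := (_ 0 1)%:~R.
set c := (_ 1 0)%:~R; set d := (_ 1 1)%:~R => ey ez.
have yz0 : y - z != 0 by rewrite subr_eq0.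
apply: (mulfI yz0).
have e1 : (y - z) * (c * (y + z) + (d - a)) = 0.
  have -> : (y - z) * (c * (y + z) + (d - a)) =
    (y * (c * y + d) - (a * y + b)) - (z * (c * z + d) - (a * z + b)) by ring.
  by rewrite ey ez !subrr.
have {e1} e1 : a = c * (y + z) + d.
  by move/eqP: e1; rewrite mulf_eq0 (negPf yz0) /= => /eqP; lra.
have e2 : b = y * (c * y + d) - a * y by rewrite -ey; ring.
by rewrite e2 e1; ring.
Qed.

Lemma ractU x : ract pglU x = x^-1.
Proof.
rewrite /pglU ract_pi /numer /denom /= !mxE /=.
by rewrite mul0r mul1r add0r addr0 mul1r.
Qed.

Lemma ractV x : ract pglV x = - x.
Proof.
rewrite /pglV ract_pi /numer /denom /= !mxE /=.
by rewrite mul0r rmorphN1 mulN1r add0r addr0 divr1.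
Qed.

Lemma ractK1 x : ract pglK x = 1 - x.
Proof.
rewrite /pglK ract_pi /numer /denom /= !mxE /=.
by rewrite mul0r rmorphN1 mulN1r add0r divr1 addrC.
Qed.

Lemma irrational_neq0 x : irrational x -> x != 0.
Proof. by move=> xirr; apply/eqP => x0; apply: xirr; exists 0 => //; rewrite rmorph0. Qed.

Lemma irrationalV x : irrational x -> irrational x^-1.
Proof. by rewrite -ractU; exact: irrational_ract. Qed.

Lemma irrationalN x : irrational x -> irrational (- x).
Proof. by rewrite -ractV; exact: irrational_ract. Qed.

Lemma ract_flip e x : ract (flip e) x = if e then x^-1 else x.
Proof. by case: e; rewrite ?ractU ?ract1. Qed.

Lemma stretch_flip e x : irrational x -> stretch (flip e) x = 1.
Proof.
move=> xirr; case: e; last exact: stretch1.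
rewrite /pglU stretch_pi /numer /denom /= !mxE /=.
by rewrite mul0r !mul1r add0r addr0 normr1 addrC divff // gt_eqF ?norm1_gt0.
Qed.

Lemma ract_letter b x : irrational x -> 0 < x ->
  ract (letter b) x = if b then x / (x + 1) else x + 1.
Proof.
move=> xirr x0; case: b; last first.
  by rewrite letter0 ractM// ractV ractK1 opprK addrC.
have xVirr : irrational (ract pglU x) by exact: irrational_ract.
rewrite /letter ractM// [flip true]/= ractM// [ract (_ * _)%g _]ractM//.
rewrite !ractU ractV ractK1 opprK.
by field; rewrite !gt_eqF ?addr_gt0.
Qed.

Lemma ract_letter_gt0 b x : irrational x -> 0 < x -> 0 < ract (letter b) x.
Proof.
by move=> xirr x0; rewrite ract_letter//; case: b; rewrite ?divr_gt0 ?addr_gt0.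
Qed.

(** A letter adds one of the positive coordinates of (x, 1) to the other one. *)
Lemma stretch_letter b x : irrational x -> 0 < x -> 1 < stretch (letter b) x.
Proof.
have s0 z : irrational z -> 0 < z -> 1 < stretch (letter false) z.
  move=> zirr z0.

  rewrite letter0 stretchM// ractV /pglK /pglV !stretch_pi /numer /denom /= !mxE /=.
  rewrite !rmorphN1 !mulN1r opprK !mul0r !add0r addr0 normr1 normrN.
  rewrite !ger0_norm ?addr_ge0 ?ltW// mulfV ?gt_eqF ?addr_gt0// mulr1.
  by rewrite ltr_pdivlMr ?addr_gt0// mul1r ltrDl.
case: b => [xirr x0|]; last exact: s0.
have xVirr : irrational (ract pglU x) by exact: irrational_ract.
have xV0 : 0 < ract pglU x by rewrite ractU invr_gt0.
rewrite /letter stretchM// [stretch (flip true) x]stretch_flip// mulr1 [flip true]/=.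
rewrite stretchM// [stretch pglU _](stretch_flip true) ?mul1r; last first.
  exact: irrational_ract.
by rewrite -letter0; exact: s0.
Qed.

Lemma ract_word_gt0 q x : irrational x -> 0 < x -> 0 < ract (word q) x.
Proof.
move=> xirr x0; elim: q => [|b q IH] /=; first by rewrite ract1.
by rewrite ractM// ract_letter_gt0//; exact: irrational_ract.
Qed.

Lemma stretch_word q x : irrational x -> 0 < x -> (0 < size q)%N ->
  1 < stretch (word q) x.
Proof.
move=> xirr x0; case: q => // b q _.
have qirr r : irrational (ract (word r) x) by exact: irrational_ract.
elim: q b => [|c q IH] b.
  by rewrite [word _]mulg1; exact: stretch_letter.
rewrite -[word _]/(letter b * word (c :: q))%g stretchM//.
apply: mulr_egt1; last exact: IH.
by apply: stretch_letter => //; exact: ract_word_gt0.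
Qed.

(** On positive numbers, the letter 0 takes values above 1 and the letter 1
    values below 1. *)
Lemma ract_letter_inj b c x y : irrational x -> irrational y -> 0 < x -> 0 < y ->
  ract (letter b) x = ract (letter c) y -> b = c /\ x = y.
Proof.
move=> xirr yirr x0 y0 e; have bc : b = c.
  move: e; rewrite !ract_letter//.
  have lt1 z : 0 < z -> z / (z + 1) < 1.
    by move=> z0; rewrite ltr_pdivrMr ?addr_gt0// mul1r ltrDl.
  have := lt1 x x0; have := lt1 y y0; case: b c => -[] //; lra.
split=> //; rewrite -(ractK (letter b) xirr) e bc ractK//.
Qed.

End RealAction.

(** * Dynamics near an irrational fixed point *)

Section Dynamics.
Variable R : realType.
Implicit Types (x y r : R) (g : PGL2Z).

Lemma irrationalDq x (q : rat) : irrational x -> irrational (x + ratr q).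
Proof.
move=> xirr [p _ e]; apply: xirr; exists (p - q) => //.
by rewrite rmorphB /= e addrK.
Qed.

(** If |c x + d| = 1 with x irrational, then c = 0. *)
Lemma stretch1_scalar g x : irrational x -> ract g x = x -> stretch g x = 1 ->
  [/\ gl2z_mx (repr g) 1 0 = 0, gl2z_mx (repr g) 1 1 != 0,
      gl2z_mx (repr g) 0 0 = gl2z_mx (repr g) 1 1 & gl2z_mx (repr g) 0 1 = 0].
Proof.
move=> xirr gx; rewrite stretch_fixed// => L1.
have ex : numer (repr g) x = x * denom (repr g) x.
  by rewrite -[X in X * _]gx mulfVK// denom_neq0.
have [c0 d0] : gl2z_mx (repr g) 1 0 = 0 /\ gl2z_mx (repr g) 1 1 != 0.
  move: L1; rewrite /denom; case: ger0P => _ L1.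
    have [|c0 d0] := @irrational_affinez _ x (gl2z_mx (repr g) 1 0)
      (gl2z_mx (repr g) 1 1 - 1) xirr; first by rewrite rmorphB /= addrA L1 subrr.
    by split=> //; apply/eqP => d1; rewrite d1 in d0.
  have [|c0 d0] := @irrational_affinez _ x (gl2z_mx (repr g) 1 0)
    (gl2z_mx (repr g) 1 1 + 1) xirr.
    by rewrite rmorphD /= addrA; lra.
  by split=> //; apply/eqP => d1; rewrite d1 in d0.
move: ex; rewrite /numer /denom c0 mul0r add0r => ex.
have [|/eqP + b0] := @irrational_affinez _ x
  (gl2z_mx (repr g) 0 0 - gl2z_mx (repr g) 1 1) (gl2z_mx (repr g) 0 1) xirr.
  by rewrite rmorphB /= mulrBl addrAC ex mulrC subrr.
by rewrite subr_eq0 => /eqP a0; split.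
Qed.

Lemma cvg_SomeP (u : nat -> Rhat R) x : u n @[n --> \oo] --> (Some x : Rhat R) <->
  forall e, 0 < e -> \forall n \near \oo, exists2 r, u n = Some r & `|r - x| < e.
Proof.
split=> [ux e e0|ux U Ux].
  have : nbhs (Some x : Rhat R) (Some @` ball x e).
    apply: one_point_compactification_some_nbhs; exact: nbhsx_ballx.
  move=> /ux; apply: (@filterS _ \oo _) => n [r xr <-]; exists r => //.
  by rewrite distrC.
have /nbhs_ballP[e /= e0 xe] : nbhs x (Some @^-1` U) by [].
apply: (@filterS _ \oo _ _ _ _ (ux e e0)) => n [r un xr].
by rewrite /= un; apply: xe; rewrite /ball /= distrC.
Qed.

(** For a fixed point x one has
    g r - x = (det g) (r - x) / ((c r + d) (c x + d)), where |c x + d| is the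
    stretch L at x. In the radius (L - 1) / (|c| + 1) around x, |c r + d| is
    still at least 1. *)
Lemma contracting_near g x : irrational x -> ract g x = x -> 1 < stretch g x ->
  exists2 d, 0 < d & forall r, `|r - x| < d ->
    exists2 r', act g (Some r : Rhat R) = Some r' &
                `|r' - x| <= (stretch g x)^-1 * `|r - x|.
Proof.
move=> xirr gx; rewrite stretch_fixed//.
have d0 := denom_neq0 (repr g) xirr.
have ex : numer (repr g) x = x * denom (repr g) x.
  by rewrite -[X in X * _]gx mulfVK.
move: ex d0; rewrite /act /moebius /numer /denom.
have : `|(gl2z_mx (repr g) 0 0)%:~R * (gl2z_mx (repr g) 1 1)%:~R
     - (gl2z_mx (repr g) 0 1)%:~R * (gl2z_mx (repr g) 1 0)%:~R| = 1 :> R.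
  rewrite -!rmorphM -rmorphB /=.
  by case: (det_GL2Z (repr g)) => ->; rewrite ?rmorphN1 ?normrN normr1.
set a := (_ 0 0)%:~R; set b := (_ 0 1)%:~R.
set c := (_ 1 0)%:~R; set d := (_ 1 1)%:~R => D1 ex d0 L1.
set L := `|c * x + d| in L1 *.
have c0 : 0 < `|c| + 1 by rewrite ltr_wpDl.
exists ((L - 1) / (`|c| + 1)); first by rewrite divr_gt0// subr_gt0.
move=> r; rewrite ltr_pdivlMr// => rx.
have dr : 1 <= `|c * r + d|.
  have : L - `|c| * `|r - x| <= `|c * r + d|.
    rewrite lerBlDr -normrM /L.
    have -> : c * x + d = (c * r + d) - c * (r - x) by ring.
    exact: ler_normB.
  by have := normr_ge0 (r - x); lra.
have dr0 : c * r + d != 0 by rewrite -normr_gt0 (lt_le_trans _ dr).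
rewrite (negPf dr0); eexists; first by [].
have -> : (a * r + b) / (c * r + d) - x =
    (a * d - b * c) * (r - x) / ((c * r + d) * (c * x + d)).
  have eb : b = x * (c * x + d) - a * x by rewrite -ex; ring.
  by rewrite eb; field; rewrite dr0 d0.
rewrite !normrM normrV ?unitfE ?mulf_neq0// normrM D1 mul1r -/L invfM.
rewrite [leRHS]mulrC ler_wpM2l// ler_piMl ?invr_ge0//.
  exact: normr_ge0.
by rewrite invf_le1 ?(lt_le_trans _ dr).
Qed.

Lemma expanding_attracting g x : irrational x -> ract g x = x ->
  1 < stretch g x -> attracting g (Some x : Rhat R).
Proof.
move=> xirr gx s1; split; first by rewrite /fixed_point act_irr// gx.
have [d d0 gd] := contracting_near xirr gx s1.
set k := (stretch g x)^-1 in gd.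
have k0 : 0 <= k by rewrite invr_ge0 ltW// (lt_trans _ s1).
have k1 : k < 1 by rewrite invf_lt1// (lt_trans _ s1).
suff : nbhs x (fun r => iter n (act g) (Some r : Rhat R) @[n --> \oo] --> (Some x : Rhat R)) by [].
apply/nbhs_ballP; exists d => //= r; rewrite /ball /= distrC => rx.
have itn n : exists2 r', iter n (act g) (Some r : Rhat R) = Some r' &
                `|r' - x| <= k ^+ n * `|r - x|.
  elim: n => [|n [r' /= -> IH]]; first by exists r; rewrite ?mul1r.
  have r'x : `|r' - x| < d.
    by rewrite (le_lt_trans IH)// (le_lt_trans _ rx)// ler_piMl// exprn_ile1// ltW.
  have [r'' e IH'] := gd r' r'x; exists r'' => //.
  by rewrite (le_trans IH')// exprS -mulrA ler_wpM2l.
apply/cvg_SomeP => e e0.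
have : k ^+ n * `|r - x| @[n --> \oo] --> (0 * `|r - x| : R).
  by apply: cvgMl; apply: cvg_expr; rewrite ger0_norm.
rewrite mul0r => /cvgrPdist_lt/(_ e e0); apply: filterS => n.
rewrite sub0r normrN => ne; have [r' -> IH] := itn n; exists r' => //.
by rewrite (le_lt_trans IH)// (le_lt_trans _ ne)// ler_norm.
Qed.

Lemma fixed_pointP g r : fixed_point g (Some r : Rhat R) <->
  denom (repr g) r != 0 /\ numer (repr g) r = r * denom (repr g) r.
Proof.
rewrite /fixed_point /act /= -/(denom _ _) -/(numer _ _); split.
  case: ifPn => // d0 [e]; split => //.
  by rewrite -[X in X * _]e mulfVK.
by move=> [d0 e]; rewrite (negPf d0) e mulfK.
Qed.

(** The other fixed point is the Galois conjugate (a - d) / c - x of x. There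
    the eigenvalue is the inverse up to sign, so that the inverse of g is
    expanding. *)
Lemma expanding_hyperbolic g x : irrational x -> ract g x = x ->
  1 < stretch g x -> hyperbolic R g /\ attracting g (Some x : Rhat R).
Proof.
move=> xirr gx s1; split; last exact: expanding_attracting.
have d0 := denom_neq0 (repr g) xirr.
have ex : numer (repr g) x = x * denom (repr g) x.
  by rewrite -[X in X * _]gx mulfVK.
have L1 := s1; rewrite stretch_fixed// in L1.
have D := det_GL2Z (repr g).
have c0 : gl2z_mx (repr g) 1 0 != 0.
  apply/eqP => c0; have : 1 < `|gl2z_mx (repr g) 1 1|.
    by rewrite -(ltr_int R) intr_norm; move: L1; rewrite /denom c0 mul0r add0r.
  have : gl2z_mx (repr g) 0 0 * gl2z_mx (repr g) 1 1 \is a GRing.unit.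
    by move: D; rewrite c0 mulr0 subr0 => -[] ->.
  by rewrite unitrM => /andP[_]; rewrite qualifE /= => /orP[]/eqP ->.
pose a : R := (gl2z_mx (repr g) 0 0)%:~R; pose b : R := (gl2z_mx (repr g) 0 1)%:~R.
pose c : R := (gl2z_mx (repr g) 1 0)%:~R; pose d : R := (gl2z_mx (repr g) 1 1)%:~R.
have c0' : c != 0 by rewrite intr_eq0.
have eb : b = x * (c * x + d) - a * x by move: ex; rewrite /numer /denom -/a -/b -/c -/d; lra.
pose x' := (a - d) / c - x.
have x'irr : irrational x'.
  have -> : x' = - (x + ratr ((gl2z_mx (repr g) 1 1 - gl2z_mx (repr g) 0 0)%:~R
                             / (gl2z_mx (repr g) 1 0)%:~R)).
    by rewrite fmorph_div /= !ratr_int rmorphB /= -/a -/c -/d /x'; field.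
  exact/irrationalN/irrationalDq.
have gx' : fixed_point g (Some x' : Rhat R).
  apply/fixed_pointP; split; first exact: denom_neq0.
  by rewrite /numer /denom -/a -/b -/c -/d eb /x'; field.
have gx'' : ract g x' = x' by move: gx'; rewrite /fixed_point act_irr// => -[].
have s' : 1 < stretch g^-1%g x'.
  rewrite -[X in stretch _ X]gx'' stretchV// stretch_fixed//.
  have : `|denom (repr g) x * denom (repr g) x'| = 1.
    have -> : denom (repr g) x * denom (repr g) x' =
        (gl2z_mx (repr g) 0 0 * gl2z_mx (repr g) 1 1
         - gl2z_mx (repr g) 0 1 * gl2z_mx (repr g) 1 0)%:~R.
      rewrite rmorphB !rmorphM /= /denom -/a -/b -/c -/d eb /x'.
      by field.
    by case: D => ->; rewrite ?rmorphN1 ?normrN normr1.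
  rewrite normrM => e.
  have x'0 : `|denom (repr g) x'| != 0 by rewrite normr_eq0 denom_neq0.
  suff -> : `|denom (repr g) x'|^-1 = `|denom (repr g) x| by [].
  by apply: (mulIf x'0); rewrite mulVf.
exists (Some x), (Some x'); split.
- case=> e; have := s'; rewrite -e -[X in stretch _ X]gx stretchV//.
  by rewrite ltNge invf_le1 ?stretch_gt0// ltW.
- move=> [r|]; last first.
    by split=> [|[]//]; rewrite /fixed_point /act /= (negPf c0).
  split=> [/fixed_pointP[dr]|[[->]|[->]//]]; last first.
    by rewrite /fixed_point act_irr// gx.
  rewrite /numer /denom -/a -/b -/c -/d eb => er.
  have : (r - x) * (r - x') * c = 0.
    have -> : (r - x) * (r - x') * c =
        r * (c * r + d) - (a * r + (x * (c * x + d) - a * x)).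
      by rewrite /x'; field.
    by rewrite er subrr.
  move=> /eqP; rewrite !mulf_eq0 (negPf c0') orbF !subr_eq0.
  by move=> /orP[/eqP->|/eqP->]; [left|right].
- exact: expanding_attracting.
- apply: expanding_attracting => //.
  by rewrite -[X in ract _ X]gx'' ractK.
Qed.

(** If the stretch at x is below 1, the inverse of g contracts near x, and the
    orbit under g of a point near x cannot get closer to x. Starting from an
    irrational number keeps the orbit away from infinity. *)
Lemma attracting_expanding g x : irrational x -> hyperbolic R g ->
  attracting g (Some x : Rhat R) -> 1 < stretch g x.
Proof.
move=> xirr hyp [fx]; have gx : ract g x = x.
  by move: fx; rewrite /fixed_point act_irr// => -[].
rewrite ltNge => itx; apply/negP; rewrite le_eqVlt => /orP[/eqP s1|s1].
  (* g is the identity, which fixes the three points oo, 0 and 1 *)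
  have [c0 d0 a0 b0] := stretch1_scalar xirr gx s1.
  have gfix (y : Rhat R) : fixed_point g y.
    case: y => [r|]; last by rewrite /fixed_point /act /= c0.
    apply/fixed_pointP; rewrite /numer /denom c0 -a0 b0.
    have : (gl2z_mx (repr g) 1 1)%:~R != 0 :> R by rewrite intr_eq0.
    by rewrite mul0r add0r addr0 a0 mulrC; split.
  have [p [q [_ pq _ _]]] := hyp.
  have /pq N := gfix None; have /pq Z := gfix (Some 0); have /pq O := gfix (Some 1).
  have O0 : 1 <> 0 :> R by apply/eqP; exact: oner_neq0.
  by case: N Z O => N [] Z [] O; congruence.
have ix : ract g^-1%g x = x by rewrite -[X in ract _ X]gx ractK.
have s2 : 1 < stretch g^-1%g x.
  by rewrite -[X in stretch _ X]gx stretchV// invf_gt1// stretch_gt0.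
have [d d0 gd] := contracting_near xirr ix s2.
have /nbhs_ballP[e /= e0 xe] :
   nbhs x (fun r => iter n (act g) (Some r : Rhat R) @[n --> \oo] --> (Some x : Rhat R)) by [].
have [q /andP[q0 qe]] := rat_in_itvoo e0.
pose r := x + ratr q.
have rirr : irrational r by exact: irrationalDq.
have rx : r != x by rewrite -subr_eq0 /r addrC addKr gt_eqF.
have /xe : ball x e r.
  by rewrite /ball /= /r opprD addrA subrr add0r normrN gtr0_norm.
have itr n : irrational (iter n (ract g) r).
  by elim: n => //= n; exact: irrational_ract.
have actr n : iter n (act g) (Some r : Rhat R) = Some (iter n (ract g) r).
  by elim: n => //= n ->; rewrite act_irr.
pose u n := `|iter n (ract g) r - x|.
move=> /cvg_SomeP cvr; have [n0 _ u_lt] := cvr _ d0.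
have u_mon n : (n0 <= n)%N -> u n <= u n.+1.
  move=> n0n; have [s + u1] := u_lt n.+1 (leqW n0n).
  rewrite actr => -[e1]; rewrite -e1 in u1.
  have [r' + hr'] := gd _ u1; rewrite act_irr; last exact: (itr n.+1).
  rewrite ractK //.
  move=> -[e2]; rewrite -e2 in hr'; apply: (le_trans hr').
  by rewrite ler_piMl// invf_le1 ?ltW// (lt_trans _ s2).
have u_ge n : (n0 <= n)%N -> u n0 <= u n.
  elim: n => [|n IH]; first by rewrite leqn0 => /eqP ->.
  rewrite leq_eqVlt => /orP[/eqP -> //|n0n].
  by rewrite (le_trans (IH n0n))// u_mon.
have u0 n : 0 < u n.
  rewrite normr_gt0 subr_eq0; elim: n => //= n; apply: contra => /eqP e1.
  by rewrite -ix -e1 ractK.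
have [n1 _ u_lt'] := cvr _ (u0 n0).
have [s + us] := u_lt' (maxn n0 n1) (leq_maxr _ _).
rewrite actr => -[es]; rewrite -es in us.
by have := u_ge (maxn n0 n1) (leq_maxl _ _); rewrite leNgt us.
Qed.
End Dynamics.

(** * Values of binary strings *)

Definition shift n (a : bstring) : bstring := fun k => a (n + k)%N.
Definition twist e (a : bstring) : bstring := fun k => a k (+) e.

(** The strings that are not eventually constant: their values are exactly the
    positive irrationals. *)
Definition mixed (a : bstring) := forall n b, exists2 m, (n <= m)%N & a m = b.

Lemma mixed_shift n a : mixed a -> mixed (shift n a).
Proof.
move=> am k b; have [m km amb] := am (n + k)%N b.
exists (m - n)%N; first by rewrite leq_subRL// (leq_trans (leq_addr _ _) km).
by rewrite /shift subnKC// (leq_trans (leq_addr _ _) km).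
Qed.

Lemma mixed_twist e a : mixed a -> mixed (twist e a).
Proof.
move=> am n b; have [m nm amb] := am n (b (+) e).
by exists m => //; rewrite /twist amb addbK.
Qed.

Lemma not_mixed a : ~ mixed a -> exists N b, forall m, (N <= m)%N -> a m = b.
Proof.
move=> /existsNP[n /existsNP[b /forall2NP nab]]; exists n, (~~ b) => m nm.
case: (nab m) => // /eqP; by case: (a m) b {nab} => -[].
Qed.

Lemma shiftD m n a : shift m (shift n a) = shift (n + m) a.
Proof. by apply/funext => k; rewrite /shift addnA. Qed.

Lemma shift_twist n e a : shift n (twist e a) = twist e (shift n a).
Proof. by []. Qed.

Lemma twistK e a : twist e (twist e a) = a.
Proof. by apply/funext => k; rewrite /twist addbK. Qed.

Lemma run_length_Some b a n :
  (forall k, (k < n)%N -> a k = b) -> a n != b -> run_length b a = Some n.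
Proof.
move=> ab anb; rewrite /run_length; case: pselect => [ex|[]]; last by exists n.
case: ex_minnP => m amb mmin; congr Some; apply/eqP; rewrite eqn_leq mmin//=.
by rewrite leqNgt; apply/negP => mn; rewrite ab ?eqxx in amb.
Qed.

Lemma run_length_None b a : (forall k, a k = b) -> run_length b a = None.
Proof.
move=> ab; rewrite /run_length; case: pselect => [ex|//].
by case: ex_minnP => m; rewrite ab eqxx.
Qed.

Lemma run_lengthP b a : if run_length b a is Some n
  then (forall k, (k < n)%N -> a k = b) /\ a n != b else forall k, a k = b.
Proof.
rewrite /run_length; case: pselect => [ex|nex]; last first.
  by move=> k; apply/eqP/contraT => akb; exfalso; apply: nex; exists k.
case: ex_minnP => m amb mmin; split=> // k km.
by apply/eqP/contraT => /mmin; rewrite leqNgt km.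
Qed.

Lemma run_length_twist e b a : run_length (b (+) e) (twist e a) = run_length b a.
Proof.
have := run_lengthP b a; case: run_length => [n [ab an]|ab].
  apply: run_length_Some => [k kn|]; first by rewrite /twist ab.
  by apply: contraNneq an => /addIb ->.
by apply: run_length_None => k; rewrite /twist ab.
Qed.

Lemma exponents_from_twist e b a i :
  exponents_from (b (+) e) (twist e a) i = exponents_from b a i.
Proof.
elim: i a b => [|i IH] a b /=; rewrite run_length_twist//.
by case: run_length => // n; rewrite -addNb; exact: (IH (shift n a)).
Qed.

Lemma exponents_head1 a : a 0%N = true -> exponents a 0%N = Some 0.
Proof. by move=> a0; apply: (run_length_Some (b := false)) => [k|]; rewrite ?ltn0 ?a0. Qed.

(** The run of 0 is empty, and complementing turns the runs of 1 that follow
    into those of 0. *)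
Lemma exponents_tail1 a i : a 0%N = true ->
  exponents a i.+1 = exponents (twist true a) i.
Proof.
move=> a0; rewrite /exponents /= [run_length _ _](exponents_head1 a0).
by rewrite -(exponents_from_twist true).
Qed.

Lemma run_length0 a : a 0%N = false ->
  run_length false a = omap S (run_length false (shift 1 a)).
Proof.
move=> a0; have := run_lengthP false (shift 1 a).
case: run_length => [n [ab an]|ab] /=.
  by apply: run_length_Some => // -[|k]//; rewrite ltnS => /ab.
by apply: run_length_None => -[|k]//; exact: (ab k).
Qed.

Lemma exponents_tail0 a i : a 0%N = false ->
  exponents a i.+1 = exponents (shift 1 a) i.+1.
Proof.
move=> a0; rewrite /exponents /= run_length0//.
by case: run_length => //= n.
Qed.

Section ContinuedFractions.
Variable R : realType.
Implicit Types (x y : R) (a : bstring).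

Definition convergent a k : Rhat R := cfrac R (mkseq (exponents a) k).

(** The number of entries is the same on both sides: the letter 0 only increases
    the first entry, while below the letter 1 adds the entry 0. *)
Lemma convergent0 a k : a 0%N = false ->
  convergent a k.+1 = omap (fun x => 1 + x) (convergent (shift 1 a) k.+1).
Proof.
move=> a0; rewrite /convergent /mkseq /= -[iota 1 k]/(iota (1 + 0) k) iotaDl -!map_comp.
rewrite (eq_map (g := exponents (shift 1 a) \o addn 1)); last first.
  by move=> i /=; rewrite exponents_tail0.
have -> : exponents a 0 = omap S (exponents (shift 1 a) 0) by exact: run_length0.
case: (exponents (shift 1 a) 0) => //= n; case: hat_inv => //= x.
by rewrite -natr1 addrAC addrC.
Qed.

Lemma convergent1 a k : a 0%N = true ->
  convergent a k.+1 = hat_inv (convergent (twist true a) k).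
Proof.
move=> a0; rewrite /convergent /mkseq /= -[iota 1 k]/(iota (1 + 0) k) iotaDl -!map_comp.
rewrite (eq_map (g := exponents (twist true a))); last first.
  by move=> i /=; rewrite exponents_tail1.
rewrite exponents_head1//=.
by case: hat_inv => //= x; rewrite add0r.
Qed.

Lemma expr4_lt (e : R) : 0 < e -> exists j, (4 : R) ^- j < e.
Proof.
move=> e0; have /cvgrPdist_lt/(_ e e0)[j _ je] :
    (GRing.exp (4^-1 : R)) n @[n --> \oo] --> (0 : R).
  by apply: cvg_expr; rewrite ger0_norm// invf_lt1// ltr1n.
exists j; have := je j (leqnn j).
by rewrite sub0r normrN ger0_norm ?exprVn ?invr_ge0 ?exprn_ge0.
Qed.

(** Only the first exponent can vanish: the tail after a run starts with the
    letter of the next run. *)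
Lemma exponents_pos i b a : mixed a -> exists n, exponents_from b a i = Some n /\
  ((0 < i)%N || (a 0%N == b) -> (0 < n)%N).
Proof.
elim: i a b => [|i IH] a b am /=.
  have := run_lengthP b a; case: run_length => [n [ab an]|ab].
    exists n; split=> // /eqP a0; rewrite lt0n; apply: contra an => /eqP ->; exact/eqP.
  by have [m _] := am 0%N (~~ b); rewrite ab; case: b {ab}.
have := run_lengthP b a; case: run_length => [n [ab an]|ab].
  have [m [-> mpos]] := IH _ (~~ b) (mixed_shift n am).
  exists m; split=> // _; apply: mpos; apply/orP; right.
  by rewrite /shift addn0; case: (a n) b an {ab} => -[].
by have [m _] := am 0%N (~~ b); rewrite ab; case: b {ab}.
Qed.

(** The continued fraction [ns 0, ..., ns k], with k + 1 entries. *)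
Fixpoint cf (ns : nat -> nat) k : R :=
  if k is k'.+1 then (ns 0)%:R + (cf (ns \o S) k')^-1 else (ns 0)%:R.

Definition tail_pos (ns : nat -> nat) := forall i, (0 < ns i.+1)%N.

Lemma cf_bounds ns k : tail_pos ns -> (ns 0)%:R <= cf ns k <= (ns 0)%:R + 1.
Proof.
elim: k ns => [|k IH] ns nsp /=; first by rewrite lexx lerDl ler01.
have /andP[ge1 _] : (ns 1)%:R <= cf (ns \o S) k <= (ns 1)%:R + 1.
  by apply: IH => i; exact: nsp.
have {}ge1 : 1 <= cf (ns \o S) k by rewrite (le_trans _ ge1)// ler1n nsp.
by rewrite lerDl lerD2l invr_ge0 (le_trans _ ge1)//= invf_le1// (lt_le_trans _ ge1).
Qed.

Lemma convergent_cf ns a k : tail_pos ns -> (forall i, exponents a i = Some (ns i)) ->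
  convergent a k.+1 = Some (cf ns k).
Proof.
move=> nsp ea; rewrite /convergent (eq_mkseq (g := Some \o ns))//.
elim: k ns nsp {ea} => [|k IH] ns nsp; first by rewrite /= addr0.
have := IH (ns \o S) (fun i => nsp i.+1).
have -> : mkseq (Some \o ns) k.+2 = Some (ns 0) :: mkseq (Some \o (ns \o S)) k.+1.
  by rewrite /mkseq -[iota 0 k.+2]/(0%N :: iota (1 + 0) k.+1) iotaDl map_cons -map_comp.
move=> /= ->.
have /andP[ge1 _] := @cf_bounds (ns \o S) k (fun i => nsp i.+1).
by rewrite /= gt_eqF// (lt_le_trans _ ge1)// ltr0n nsp.
Qed.

(** After two steps, two tails s and t at least 1 differ by
    (s - t) / ((n s + 1) (n t + 1)), where n >= 1 is the second entry. *)
Lemma cf_cauchy j ns k l : tail_pos ns -> (j.*2 <= k)%N -> (j.*2 <= l)%N ->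
  `|cf ns k - cf ns l| <= 4 ^- j.
Proof.
elim: j ns k l => [|j IH] ns k l nsp.
  move=> _ _; rewrite expr0 invr1.
  have /andP[] := cf_bounds k nsp; have /andP[] := cf_bounds l nsp.
  by rewrite ler_norml; lra.
rewrite doubleS; case: k => [//|[//|k]]; case: l => [//|[//|l]].
rewrite !ltnS => jk jl /=.
have nsp2 : tail_pos (ns \o S \o S) by move=> i; exact: nsp.
have := IH _ _ _ nsp2 jk jl.
have /andP[s1 _] := cf_bounds k nsp2; have /andP[t1 _] := cf_bounds l nsp2.
move: s1 t1; set s := cf _ k; set t := cf _ l => s1 t1 st.
have n1 : 1 <= (ns 1)%:R :> R by rewrite ler1n nsp.
have n2 : 1 <= (ns 2)%:R :> R by rewrite ler1n nsp.
have s0 : 1 <= s by exact: le_trans s1.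
have t0 : 1 <= t by exact: le_trans t1.
move: (ns 1)%:R n1 => n n1.
have -> : (ns 0)%:R + (n + s^-1)^-1 - ((ns 0)%:R + (n + t^-1)^-1) =
  (s - t) / ((n * s + 1) * (n * t + 1)).
  by field; rewrite !lt0r_neq0 //; nra.
have -> : 4 ^- j.+1 = 4 ^- j * 4^-1 :> R by rewrite exprS invfM mulrC.
rewrite normrM; apply: ler_pM => //.
have := mulr_ege1 n1 s0; have := mulr_ege1 n1 t0.
move: (n * s) (n * t) => u v u1 v1; have uv : 4 <= (u + 1) * (v + 1) by nra.
by rewrite ger0_norm ?invr_ge0 ?lef_pV2 ?posrE; lra.
Qed.

Lemma convergent_cvg a : mixed a ->
  exists x, convergent a k @[k --> \oo] --> (Some x : Rhat R).
Proof.
move=> am.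
have /choice[ns nsP] i : exists n, exponents a i = Some n /\ ((0 < i)%N -> (0 < n)%N).
  have [n [en np]] := exponents_pos i false am.
  by exists n; split=> // i0; apply: np; rewrite i0.
have nsp : tail_pos ns by move=> i; apply: (nsP i.+1).2.
have /cauchy_cvgP/cvg_ex[/= x cx] : cauchy (cf ns k @[k --> \oo]).
  apply: cauchy_exP => e e0.
  have [j je] := expr4_lt e0.
  exists (cf ns j.*2); near_simpl; exists j.*2 => // k /= jk.
  rewrite /ball /=; apply: le_lt_trans je.
  exact: cf_cauchy.
exists x; apply/cvg_SomeP => e e0.
move/cvgrPdist_lt/(_ e e0): cx => [N _ Nx].
exists N.+1 => // -[//|k] Nk; exists (cf ns k).
  by apply: convergent_cf => // i; exact: (nsP i).1.
by rewrite distrC; exact: Nx.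
Qed.

(** Uniqueness of limits, on which the value of kappa depends. *)
Lemma Rhat_hausdorff : hausdorff_space (Rhat R).
Proof.
have noNone x : ~ cluster (nbhs (Some x : Rhat R)) None.
  set C := `[x - 1, x + 1]%classic => cl.
  have cx : nbhs x C.
    apply/nbhs_ballP; exists 1 => //= r; rewrite /ball /= ltr_distl => rx.
    by rewrite /C /= in_itv /=; lra.
  have [||p [[r rx <-] [[s sx [rs]]|//]]] := cl (Some @` C)
      ((Some @` (~` C)) `|` [set None]).
  - exact: one_point_compactification_some_nbhs.
  - exists C => //; split; first exact: segment_compact.
    exact: interval_closed.
  - by apply: sx; rewrite rs.
move=> [x|] [y|] //.
- move=> cl; congr Some; apply: (@norm_hausdorff _ R) => A B xA yB.
  have [||p [[r Ar <-] [s Bs [rs]]]] := cl (Some @` A) (Some @` B).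
  + exact: one_point_compactification_some_nbhs.
  + exact: one_point_compactification_some_nbhs.
  by exists r; split=> //; rewrite -rs.
- by move=> /noNone.
- move=> cl; exfalso; apply: (noNone y); rewrite /cluster /= => A B yA nB.
  by rewrite setIC; exact: cl.
Qed.

Lemma kappa_cvg a (p : Rhat R) :
  convergent a k @[k --> \oo] --> p -> kappa R a = p.
Proof. by move=> cvgp; exact: (cvg_lim Rhat_hausdorff). Qed.

Lemma cvg_hat_inv (u : nat -> Rhat R) x : x != 0 ->
  u n @[n --> \oo] --> (Some x : Rhat R) ->
  hat_inv (u n) @[n --> \oo] --> (Some x^-1 : Rhat R).
Proof.
move=> x0 /cvg_SomeP ux; apply/cvg_SomeP => e e0.
have : \forall r \near x, r != 0 /\ `|r^-1 - x^-1| < e.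
  have /cvgrPdist_lt/(_ e e0) rx := inv_continuous x0.
  have xn0 : \forall r \near x, r != 0 by exact: (@open_neq R 0 _).
  apply: filterS2 rx xn0 => r; rewrite distrC; by split.
move=> /nbhs_ballP[d /= d0 xd].
apply: (@filterS _ \oo _ _ _ _ (ux d d0)) => n [r -> rx].
have [|r0 re] := xd r; first by rewrite /ball /= distrC.
by exists r^-1 => //=; rewrite (negPf r0).
Qed.

Definition cval a : R := odflt 0 (kappa R a).

Lemma cval_cvg a : mixed a -> convergent a k @[k --> \oo] --> (Some (cval a) : Rhat R).
Proof. by move=> /convergent_cvg[x ax]; rewrite /cval (kappa_cvg ax). Qed.

Lemma kappa_mixed a : mixed a -> kappa R a = Some (cval a).
Proof. by move=> /cval_cvg/kappa_cvg. Qed.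

Lemma cval_unique a x : convergent a k @[k --> \oo] --> (Some x : Rhat R) ->
  cval a = x.
Proof. by move=> /kappa_cvg; rewrite /cval => ->. Qed.

Lemma cfrac_ge0 s x : cfrac R s = Some x -> 0 <= x.
Proof.
elim: s x => //= -[n|//] s IH x; case: (cfrac R s) IH => [y|] IH /=.
  case: eqP => // _ [<-]; rewrite addr_ge0// invr_ge0; exact: IH.
by move=> [<-]; rewrite addr0.
Qed.

Lemma cval_ge0 a : mixed a -> 0 <= cval a.
Proof.
move=> /cval_cvg/cvg_SomeP ca; rewrite leNgt; apply/negP => a0.
have [N _ aN] := ca (- cval a) ltac:(by rewrite oppr_gt0).
have [r /cfrac_ge0 r0] := aN N (leqnn N).
by rewrite ltr_norml; lra.
Qed.

Lemma cval_false a : mixed a -> a 0%N = false -> cval a = cval (shift 1 a) + 1.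
Proof.
move=> am a0; apply: cval_unique.
have /cvg_SomeP ca := cval_cvg (mixed_shift 1 am).
apply/cvg_SomeP => e e0; have [N _ aN] := ca e e0.
exists N.+1 => // -[//|k] Nk; rewrite convergent0//.
have [r -> re] := aN k.+1 (ltnW Nk); exists (1 + r) => //.
by rewrite (_ : _ - _ = r - cval (shift 1 a))//; ring.
Qed.

Lemma cval_true a : mixed a -> a 0%N = true -> cval a = (cval (twist true a))^-1.
Proof.
move=> am a0; apply: cval_unique.
have tm := mixed_twist true am.
have t0 : twist true a 0%N = false by rewrite /twist a0.
rewrite -cvg_shiftS; under eq_fun do rewrite convergent1//.
apply: cvg_hat_inv; last exact: cval_cvg.
by rewrite cval_false// gt_eqF// ltr_wpDl// cval_ge0//; exact: mixed_shift.
Qed.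

Lemma cval_gt0 a : mixed a -> 0 < cval a.
Proof.
move=> am; case a0 : (a 0%N); last first.
  by rewrite cval_false// ltr_wpDl// cval_ge0//; exact: mixed_shift.
rewrite cval_true// invr_gt0 cval_false; last by rewrite /twist a0.
  by rewrite ltr_wpDl// cval_ge0//; exact/mixed_shift/mixed_twist.
exact: mixed_twist.
Qed.

Lemma cval_complement a : mixed a -> cval (twist true a) = (cval a)^-1.
Proof.
move=> am; case a0 : (a 0%N); first by rewrite [in RHS]cval_true// invrK.
rewrite cval_true ?twistK//; first exact: mixed_twist.
by rewrite /twist a0.
Qed.

Lemma cval_head_true a : mixed a -> a 0%N = true ->
  cval a = cval (shift 1 a) / (cval (shift 1 a) + 1).
Proof.
move=> am a0; have tm := mixed_twist true am; have sm := mixed_shift 1 am.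
rewrite cval_true// cval_false ?/twist ?a0// -/(twist true a) shift_twist.
rewrite cval_complement//; have := cval_gt0 sm.
by move=> x0; field; rewrite !gt_eqF// addr_gt0.
Qed.

(** Removing the first letter subtracts one of the numerator and the denominator
    from the other, so that a positive rational value would lead to an infinite
    descent. *)
Lemma irrational_cval a : mixed a -> irrational (cval a).
Proof.
move=> am /rationalP[z [q e]].
have [p ez] : exists p : nat, cval a = p%:R / q%:R.
  have := cval_gt0 am; rewrite e => h; case: z h {e} => p h; first by exists p.
  exfalso; move: h; rewrite NegzE mulrNz mulNr oppr_gt0 ltNge.
  by rewrite divr_ge0// ler0z.
have [n] := ubnP (p + q); elim: n a p q am ez {e} => // n IH a p q am e pq.
have sm := mixed_shift 1 am; have s0 := cval_gt0 sm; have a0 := cval_gt0 am.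
have q0 : (0 < q)%N.
  by rewrite lt0n; apply/eqP => q0; move: a0; rewrite e q0 invr0 mulr0 ltxx.
have p0 : (0 < p)%N.
  by rewrite lt0n; apply/eqP => p0; move: a0; rewrite e p0 mul0r ltxx.
have q0' : q%:R != 0 :> R by rewrite pnatr_eq0 -lt0n.
case a00 : (a 0%N).
  have se : cval (shift 1 a) = p%:R / (q%:R - p%:R).
    have a1 : 1 - cval a != 0.
      rewrite cval_head_true//.
      have -> : 1 - cval (shift 1 a) / (cval (shift 1 a) + 1) =
         (cval (shift 1 a) + 1)^-1 by field; rewrite gt_eqF ?addr_gt0.
      by rewrite invr_eq0 gt_eqF ?addr_gt0.
    have -> : cval (shift 1 a) = cval a / (1 - cval a).
      move: a1; rewrite cval_head_true//; move: (cval _) s0 => x x0 _.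
      by field; rewrite !gt_eqF//; lra.
    move: a1; rewrite e => a1; field; rewrite q0' andbT.
    by apply: contra a1; rewrite subr_eq0 => /eqP <-; rewrite divff ?subrr.
  have pq' : (p < q)%N.
    rewrite -(ltr_nat R) -subr_gt0 ltNge; apply/negP => h.
    by move: s0; rewrite se ltNge mulr_ge0_le0 ?invr_le0.
  apply: (IH _ p (q - p)%N sm); first by rewrite natrB// ltnW.
  by rewrite subnKC ?(ltnW pq')// -ltnS (leq_trans _ pq)// ltnS -[X in (X < _)%N]add0n ltn_add2r.
have se : cval (shift 1 a) = (p%:R - q%:R) / q%:R.
  by rewrite mulrBl divff// -e [cval a]cval_false// addrK.
have pq' : (q < p)%N.
  rewrite -(ltr_nat R) -subr_gt0; move: s0; rewrite se pmulr_lgt0//.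
  by rewrite invr_gt0 ltr0n.
apply: (IH _ (p - q)%N q sm); first by rewrite natrB// ltnW.
by rewrite subnK ?(ltnW pq')// -ltnS (leq_trans _ pq)// ltnS -[X in (X < _)%N]addn0 ltn_add2l.
Qed.

Lemma cval_step a : mixed a -> cval a = ract (letter (a 0%N)) (cval (shift 1 a)).
Proof.
move=> am; have sm := mixed_shift 1 am.
rewrite ract_letter ?cval_gt0 ?irrational_cval//; last exact: irrational_cval.
case a0 : (a 0%N); [exact: cval_head_true|exact: cval_false].
Qed.

Lemma cval_prefix a n : mixed a ->
  cval a = ract (word (mkseq a n)) (cval (shift n a)).
Proof.
move=> am; elim: n => [|n ->]; first by rewrite ract1.
rewrite mkseqS word_rcons ractM; last by apply/irrational_cval/mixed_shift.
rewrite (cval_step (mixed_shift n am)) shiftD addn1.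
by rewrite {1}/shift addn0.
Qed.

Lemma cval_twist e a : mixed a -> cval (twist e a) = ract (flip e) (cval a).
Proof.
move=> am; rewrite ract_flip; case: e; first exact: cval_complement.
by congr cval; apply/funext => k; rewrite /twist addbF.
Qed.

Lemma cval_letter_inj a b x : mixed a -> irrational x -> 0 < x ->
  ract (letter b) x = cval a -> b = a 0%N /\ x = cval (shift 1 a).
Proof.
move=> am xirr x0; rewrite cval_step// => /ract_letter_inj; apply=> //.
- exact/irrational_cval/mixed_shift.
- exact/cval_gt0/mixed_shift.
Qed.

Lemma cval_word_inj a q x : mixed a -> irrational x -> 0 < x ->
  ract (word q) x = cval a -> q = mkseq a (size q) /\ x = cval (shift (size q) a).
Proof.
elim: q a => [|b q IH] a am xirr x0; first by rewrite ract1.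
have qirr : irrational (ract (word q) x) by exact: irrational_ract.
have q0 : 0 < ract (word q) x by exact: ract_word_gt0.
rewrite [word _]/(letter b * word q)%g ractM//.
move=> /(cval_letter_inj am qirr q0)[-> /(IH _ (mixed_shift 1 am) xirr x0)[eq ex]].
split; last by rewrite ex shiftD.
rewrite [size _]/= {1}eq /mkseq -[iota 0 (size q).+1]/(0%N :: iota (1 + 0) (size q)).
by rewrite iotaDl map_cons -map_comp.
Qed.

Lemma cval_inj a b : mixed a -> mixed b -> cval a = cval b -> a = b.
Proof.
move=> am bm e; apply/funext => n.
elim: n a b am bm e => [|n IH] a b am bm; rewrite cval_step//.
  move=> /(cval_letter_inj bm)[] //.
  - exact/irrational_cval/mixed_shift.
  - exact/cval_gt0/mixed_shift.
move=> /(cval_letter_inj bm)[||_ e].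
- exact/irrational_cval/mixed_shift.
- exact/cval_gt0/mixed_shift.
- exact: (IH _ _ (mixed_shift 1 am) (mixed_shift 1 bm) e).
Qed.

Lemma ract_letter_contract b x y : irrational x -> irrational y -> 0 < x -> 0 < y ->
  `|ract (letter b) x - ract (letter b) y| <= `|x - y|.
Proof.
move=> xirr yirr x0 y0; rewrite !ract_letter//; case: b; last first.
  by rewrite (_ : _ - _ = x - y)//; ring.
have -> : x / (x + 1) - y / (y + 1) = (x - y) / ((x + 1) * (y + 1)).
  by field; rewrite !gt_eqF// addr_gt0.
rewrite normrM ler_piMr// ger0_norm ?invr_ge0 ?invf_le1; nra.
Qed.

Lemma ract_letter1_contract x y : irrational x -> irrational y -> 1 < x -> 1 < y ->
  `|ract (letter true) x - ract (letter true) y| <= `|x - y| * 4^-1.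
Proof.
move=> xirr yirr x1 y1; have x0 := lt_trans ltr01 x1; have y0 := lt_trans ltr01 y1.
rewrite !ract_letter//.
have -> : x / (x + 1) - y / (y + 1) = (x - y) / ((x + 1) * (y + 1)).
  by field; rewrite !gt_eqF// addr_gt0.
rewrite normrM ler_wpM2l// ger0_norm ?invr_ge0 ?lef_pV2 ?posrE; nra.
Qed.

(** Values after a letter 1 are below 1, so that the distance is at most 1; every
    pair of letters 10 that precedes divides this bound by 4. *)
Lemma orbit_unique a (x y : nat -> R) : mixed a ->
  (forall j, irrational (x j)) -> (forall j, irrational (y j)) ->
  (forall j, 0 < x j) -> (forall j, 0 < y j) ->
  (forall j, x j = ract (letter (a j)) (x j.+1)) ->
  (forall j, y j = ract (letter (a j)) (y j.+1)) -> x 0%N = y 0%N.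
Proof.
move=> am xirr yirr x0 y0 xS yS.
have mono j k : `|x j - y j| <= `|x (j + k)%N - y (j + k)%N|.
  elim: k j => [|k IH] j; first by rewrite addn0.
  rewrite addnS -addSn; apply: le_trans (IH j.+1).
  by rewrite [x j]xS [y j]yS; exact: ract_letter_contract.
have mono' j k : (j <= k)%N -> `|x j - y j| <= `|x k - y k|.
  by move=> jk; rewrite -(subnKC jk); exact: mono.
have lt1 (z : R) : 0 < z -> 0 < z / (z + 1) < 1.
  move=> z0; apply/andP; split; first by rewrite divr_gt0// addr_gt0.
  by rewrite ltr_pdivrMr ?addr_gt0// mul1r ltrDl.
have small m j : `|x j - y j| <= 4 ^- m.
  elim: m j => [|m IH] j.
    have [k jk ak] := am j true; apply: (le_trans (mono' _ _ jk)).
    rewrite [x k]xS [y k]yS ak !ract_letter// expr0 invr1.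
    have /andP[? ?] := lt1 _ (x0 k.+1); have /andP[? ?] := lt1 _ (y0 k.+1).
    by rewrite ler_norml; lra.
  have [k jk [ak ak1]] : exists2 k, (j <= k)%N & a k = true /\ a k.+1 = false.
    have [k jk ak] := am j true; have [l kl al] := am k false.
    elim: l kl al => [|l IHl]; first by rewrite leqn0 => /eqP <-; rewrite ak.
    rewrite leq_eqVlt => /orP[/eqP <-|]; first by rewrite ak.
    rewrite ltnS => kl al; case all : (a l); last exact: IHl.
    by exists l => //; exact: leq_trans kl.
  apply: (le_trans (mono' _ _ jk)); rewrite [x k]xS [y k]yS ak.
  have gt1 (z : nat -> R) : (forall j, irrational (z j)) -> (forall j, 0 < z j) ->
      (forall j, z j = ract (letter (a j)) (z j.+1)) -> 1 < z k.+1.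
    by move=> zirr z0 zS; rewrite zS ak1 ract_letter// ltrDr.
  apply: le_trans (ract_letter1_contract _ _ _ _) _ => //; try exact: gt1.
  by rewrite exprS invfM mulrC ler_wpM2l.
apply/eqP/contraT; rewrite -subr_eq0 -normr_gt0 => /expr4_lt[m].
by rewrite ltNge small.
Qed.

Definition drop_letter x : R := if 1 < x then x - 1 else x / (1 - x).

Lemma irrational_neq1 x : irrational x -> x != 1.
Proof. by move=> xirr; apply/eqP => x1; apply: xirr; exists 1 => //; rewrite rmorph1. Qed.

Lemma drop_letterP x : irrational x -> 0 < x ->
  [/\ irrational (drop_letter x), 0 < drop_letter x &
      x = ract (letter (~~ (1 < x))) (drop_letter x)].
Proof.
move=> xirr x0; rewrite /drop_letter; case: ifPn => x1.
  have xirr' : irrational (x - 1) by rewrite -[1](rmorph1 (@ratr R)) -rmorphN; exact: irrationalDq.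
  by rewrite ract_letter ?subr_gt0// subrK; split.
have {}x1 : x < 1 by rewrite lt_neqAle irrational_neq1//= leNgt.
have xV : x / (1 - x) = (x^-1 - 1)^-1.
  by field; rewrite !gt_eqF ?subr_gt0 ?invf_gt1//; lra.
have xirr' : irrational (x / (1 - x)).
  rewrite xV; apply: irrationalV.
  by rewrite -[1](rmorph1 (@ratr R)) -rmorphN; exact/irrationalDq/irrationalV.
have x0' : 0 < x / (1 - x) by rewrite divr_gt0// subr_gt0.
split=> //; rewrite ract_letter//=.
by field; rewrite !gt_eqF//; lra.
Qed.

(** The letters of x are those of the subtractive Euclidean algorithm. If they
    were eventually constant, 1 could be subtracted forever from a positive number,
    a tail of x or its inverse. *)
Lemma cval_surj x : irrational x -> 0 < x -> exists2 a, mixed a & x = cval a.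
Proof.
move=> xirr x0; pose xs n := iter n drop_letter x.
pose a n := ~~ (1 < xs n).
have xsP n : irrational (xs n) /\ 0 < xs n.
  elim: n => [|n [nirr n0]]; first by [].
  by have [? ? _] := drop_letterP nirr n0.
have xs_irr n : irrational (xs n) by case: (xsP n).
have xs_gt0 n : 0 < xs n by case: (xsP n).
have xsS n : xs n = ract (letter (a n)) (xs n.+1).
  by case: (drop_letterP (xs_irr n) (xs_gt0 n)).
have am : mixed a.
  apply: contrapT => /not_mixed[N [b ab]].
  have lin k : if b then (xs N)^-1 = (xs (N + k)%N)^-1 + k%:R
               else xs N = xs (N + k)%N + k%:R.
    elim: k => [|k]; first by rewrite !addn0 !addr0; case: (b).
    rewrite addnS [xs (N + k)%N]xsS ab ?leq_addr// ract_letter//.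
    have z0 := xs_gt0 (N + k).+1; move: (xs (N + k).+1) z0 => z z0.
    case: (b) => ->; last by rewrite -addrA nat1r.
    by rewrite -nat1r; field; rewrite !gt_eqF ?addr_gt0.
  pose y := if b then (xs N)^-1 else xs N.
  have y0 : 0 <= y by rewrite /y; case: (b); rewrite ?invr_ge0 ltW.
  have := archi_boundP y0; move: (Num.bound y) => k.
  rewrite ltNge => /negP; apply; move: (lin k); rewrite /y.
  have := xs_gt0 (N + k)%N.
  by case: (b) => z0 ->; rewrite lerDr ?invr_ge0 ltW.
exists a => //; rewrite -[x]/(xs 0%N) -[a in RHS]/(shift 0 a).
apply: (@orbit_unique a xs (fun j => cval (shift j a))) => //.
- by move=> j; exact/irrational_cval/mixed_shift.
- by move=> j; exact/cval_gt0/mixed_shift.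
- move=> j; rewrite (cval_step (mixed_shift j am)) shiftD addn1.
  by rewrite {1}/shift addn0.
Qed.

(** Dropping the letters one by one leads to a constant string, whose
    convergents are oo if the letter is 0, and 0 if it is 1. *)
Lemma convergent_not_mixed a : ~ mixed a ->
  exists (p : option rat) N, forall k, (N <= k)%N -> convergent a k = omap ratr p.
Proof.
move=> /not_mixed[n [b]]; elim: n a b => [|n IH] a b ab.
  have cst (c : bstring) k : (forall i, c i = false) -> convergent c k = None.
    move=> c0; case: k => [//|k].
    by rewrite /convergent /= [exponents c 0]run_length_None.
  case: b ab => ab; last first.
    by exists None, 0%N => k _; rewrite cst// => i; exact: ab.
  exists (Some 0), 1%N => -[//|k] _; rewrite convergent1 ?ab// cst /= ?rmorph0//.
  by move=> i; rewrite /twist ab.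
wlog a0 : a b ab / a 0%N = false.
  move=> wl; case a0 : (a 0%N); last exact: (wl a b).
  have [||p [N pN]] := wl (twist true a) (~~ b).
  - by move=> m nm; rewrite /twist ab// addbT.
  - by rewrite /twist a0.
  exists (if p is Some q then if q == 0 then None else Some q^-1 else Some 0), N.+1.
  move=> [//|k] Nk; rewrite convergent1// pN//.
  case: p {pN} => [q|] /=; last by rewrite rmorph0.
  by rewrite fmorph_eq0; case: (q == 0) => //=; rewrite fmorphV.
have [p [N pN]] := IH (shift 1 a) b (fun m nm => ab m.+1 nm).
exists (omap (fun q => 1 + q) p), N.+1 => -[//|k] Nk.
rewrite convergent0// pN ?(leqW Nk)//; last exact: leqW.
by case: p {pN} => //= q; rewrite rmorphD rmorph1.
Qed.

Lemma kappa_irrational_mixed a x : kappa R a = Some x -> irrational x -> mixed a.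
Proof.
move=> ax xirr; apply: contrapT => /convergent_not_mixed[p [N pN]]; apply: xirr.
have : convergent a k @[k --> \oo] --> (omap ratr p : Rhat R).
  by apply: cvg_near_cst; exists N => // k /= Nk; rewrite pN.
by move=> /kappa_cvg; rewrite ax; case: p {pN} => //= q [->]; exists q.
Qed.

Lemma kappa_inv_cval a : mixed a -> kappa_inv (cval a) = a.
Proof.
move=> am; have ka : kappa R a = Some (cval a) by exact: kappa_mixed.
have kb : kappa R (kappa_inv (cval a)) = Some (cval a).
  exact: (@xgetPex _ phi [set b | kappa R b = Some (cval a)] (ex_intro _ a ka)).
have bm := kappa_irrational_mixed kb (irrational_cval am).
by apply: cval_inj => //; move: kb; rewrite (kappa_mixed bm) => -[].
Qed.

Lemma mixed_phi : mixed phi.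
Proof.
move=> n b; case: (altP (odd n =P b)) => nb; first by exists n.
by exists n.+1 => //; rewrite /phi /=; case: (odd n) b nb => -[].
Qed.

(** The string phi is 0 followed by the complement of phi: its value t satisfies
    t = 1 + 1 / t. *)
Lemma cval_phi : cval phi = (1 + Num.sqrt 5) / 2.
Proof.
have t0 := cval_gt0 mixed_phi; have : cval phi = (cval phi)^-1 + 1.
  rewrite {1}cval_false//; last exact: mixed_phi.
  have -> : shift 1 phi = twist true phi.
    by apply/funext => k; rewrite /shift /twist /phi /= addbT.
  by rewrite cval_complement//; exact: mixed_phi.
move: (cval phi) t0 => t t0 et.
have t2 : t ^+ 2 = t + 1.
  have : t * t = t * (t^-1 + 1) by rewrite -et.
  by rewrite mulrDr mulfV ?gt_eqF// mulr1 addrC.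
have s5 : (2 * t - 1) ^+ 2 = 5.
  have -> : (2 * t - 1) ^+ 2 = 4 * (t ^+ 2 - t) + 1 by ring.
  by rewrite t2; ring.
 have t1 : 0 <= 2 * t - 1 by nra.
by rewrite -s5 sqrtr_sqr ger0_norm//; field.
Qed.

(** Otherwise a is eventually alternating, hence ends like phi or its
    complement, and its value lies in the orbit of the golden ratio. *)
Lemma not_noble_mixed a : mixed a -> ~ noble (Some (cval a) : Rhat R) ->
  mixed (bxor a phi).
Proof.
move=> am nn; apply: contrapT => /not_mixed[n [b ab]]; apply: nn.
have sa : shift n a = twist (b (+) odd n) phi.
  apply/funext => k; have := ab (n + k)%N (leq_addr _ _).
  rewrite /bxor /shift /twist /phi oddD.
  by case: (a (n + k)%N) b (odd n) (odd k) {ab} => -[] -[] -[].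
have phi_irr := irrational_cval mixed_phi.
exists (word (mkseq a n) * flip (b (+) odd n))%g.
rewrite -cval_phi act_irr// ractM// -cval_twist; last exact: mixed_phi.
by rewrite -sa -cval_prefix.
Qed.

End ContinuedFractions.

(** * Common tails of equivalent numbers *)

Lemma bxorK a b : bxor (bxor a b) b = a.
Proof. by apply/funext => k; rewrite /bxor addbK. Qed.

Lemma twist_shift_bxor_phi e m n a b : twist e (shift m a) = shift n b ->
  twist (odd n (+) e (+) odd m) (shift m (bxor a phi)) = shift n (bxor b phi).
Proof.
move=> tab; apply/funext => k; have := congr1 (@^~ k) tab.
rewrite /twist /shift /bxor /phi !oddD => <-.
by move: (a _) (odd m) (odd n) (odd k) e {tab} => -[] [] [] [] [].
Qed.

Lemma mkseq_add a m k : mkseq a (m + k) = mkseq a m ++ mkseq (shift m a) k.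
Proof.
by rewrite /mkseq iotaD map_cat add0n -[X in iota X k]addn0 iotaDl -map_comp.
Qed.

Lemma flipV e : (flip e)^-1%g = flip e.
Proof. by apply: (mulgI (flip e)); rewrite mulgV flipM addbb. Qed.

Section Tails.
Variable R : realType.
Implicit Types (a b : bstring) (g : PGL2Z).

Local Notation cval := (cval R).

Definition prefix_stretch n a : R := stretch (word (mkseq a n)) (cval (shift n a)).

Lemma prefix_stretch_gt0 n a : mixed a -> 0 < prefix_stretch n a.
Proof. by move=> am; apply/stretch_gt0/irrational_cval/mixed_shift. Qed.

Lemma prefix_stretch_lt m n a : mixed a -> (m < n)%N ->
  prefix_stretch m a < prefix_stretch n a.
Proof.
move=> am mn; have -> : prefix_stretch n a = prefix_stretch m a *
    stretch (word (mkseq (shift m a) (n - m))) (cval (shift n a)).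
  have sI : irrational (cval (shift n a)) by exact/irrational_cval/mixed_shift.
  rewrite /prefix_stretch -{1}(subnKC (ltnW mn)) mkseq_add word_cat stretchM//.
  by rewrite -{2}(subnKC (ltnW mn)) -shiftD -cval_prefix//; exact: mixed_shift.
rewrite ltr_pMr ?prefix_stretch_gt0//; apply: stretch_word.
- exact/irrational_cval/mixed_shift.
- exact/cval_gt0/mixed_shift.
- by rewrite size_mkseq subn_gt0.
Qed.

(** The stretch of a change of prefix, at a number with a given tail, compares
    the lengths of the two prefixes. *)
Lemma prefix_stretch_ratio m n a : mixed a ->
  (1 < prefix_stretch n a / prefix_stretch m a) = (m < n)%N.
Proof.
move=> am; rewrite ltr_pdivlMr ?prefix_stretch_gt0// mul1r.
by case: (ltngtP m n) => [mn|nm|->]; [exact: prefix_stretch_lt| |exact: ltxx];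
  apply/negbTE; rewrite -leNgt ltW// prefix_stretch_lt.
Qed.

(** Removes the first m letters of a, applies U if e holds, and prepends the
    first n letters of b. *)
Definition transit n b e m a : PGL2Z :=
  (word (mkseq b n) * flip e * (word (mkseq a m))^-1)%g.

Lemma ract_transit n b e m a : mixed a -> mixed b ->
  twist e (shift m a) = shift n b ->
  ract (transit n b e m a) (cval a) = cval b /\
  stretch (transit n b e m a) (cval a) = prefix_stretch n b / prefix_stretch m a.
Proof.
move=> am bm tab; have aI := irrational_cval (R:=R) am.
have sI := irrational_cval (R:=R) (mixed_shift m am).
have sa0 : ract (word (mkseq a m))^-1%g (cval a) = cval (shift m a).
  by rewrite (cval_prefix R m am) ractK.
have fI : irrational (ract (flip e) (cval (shift m a))) by exact: irrational_ract.
have e1 : ract (flip e) (cval (shift m a)) = cval (shift n b).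
  by rewrite -tab cval_twist//; exact: mixed_shift.
rewrite /transit ractM// stretchM// sa0 ractM// stretchM// e1 -cval_prefix//.
by rewrite stretch_flip// mulr1 {1}(cval_prefix R m am) stretchV.
Qed.

(** Serret's theorem on equivalent numbers. Straightening g along a writes
    cval b as a word applied to a tail of a, complemented if e holds; the sign
    cannot occur as cval b is positive. The expansion being unique, this word is a
    prefix of b. *)
Lemma serret a b g : mixed a -> mixed b -> ract g (cval a) = cval b ->
  exists n e m, twist e (shift m a) = shift n b /\ g = transit n b e m a.
Proof.
move=> am bm gab; have [m [v [q [e E]]]] := straighten g a.
have sm := mixed_shift m am; have sI := irrational_cval (R:=R) sm.
have tI := irrational_cval (R:=R) (mixed_twist e sm).
have t0 := cval_gt0 R (mixed_twist e sm).
have gq : ract (mirror v) (ract (word q) (cval (twist e (shift m a)))) = cval b.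
  by rewrite -gab (cval_prefix R m am) -(ractM g)// E ractM// -cval_twist// ractM.
case: v E gq => E gq.
  have := cval_gt0 R bm; rewrite -gq ractV oppr_gt0 ltNge.
  by rewrite ltW// ract_word_gt0.
move: gq; rewrite ract1 => /(cval_word_inj bm tI t0)[eq ex].
exists (size q), e, m; split.
  by apply: cval_inj ex; [exact: mixed_twist|exact: mixed_shift].
rewrite /transit -eq; apply: (mulIg (word (mkseq a m))).
by rewrite E mul1g -!mulgA mulVg mulg1.
Qed.

Section Dyer.
Variables (J : PGL2Z -> PGL2Z) (hJ : dyer_automorphism J).

Lemma dyer_transit n b e m a : J (transit n b e m a) =
  transit n (bxor b phi) (odd n (+) e (+) odd m) m (bxor a phi).
Proof.
rewrite /transit !(dyerM hJ) (dyerV hJ) !(dyer_prefix hJ) (dyer_flip hJ).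
by rewrite invgM flipV -!flipM !mulgA.
Qed.

(** A common tail of a and b is a common tail of a + phi and b + phi up to
    complement: this makes the action of g compatible with that of J g. *)
Lemma dyer_equivariant a b g : mixed a -> mixed b ->
  mixed (bxor a phi) -> mixed (bxor b phi) -> ract g (cval a) = cval b ->
  exists n m,
  [/\ exists e, twist e (shift m a) = shift n b,
      stretch g (cval a) = prefix_stretch n b / prefix_stretch m a,
      ract (J g) (cval (bxor a phi)) = cval (bxor b phi) &
      stretch (J g) (cval (bxor a phi)) =
        prefix_stretch n (bxor b phi) / prefix_stretch m (bxor a phi)].
Proof.
move=> am bm am' bm' /(serret am bm)[n [e [m [tab ->]]]]; exists n, m.
rewrite dyer_transit; have [_ ->] := ract_transit am bm tab.
by have [-> ->] := ract_transit am' bm' (twist_shift_bxor_phi tab); split=> //; exists e.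
Qed.

(** e would have to be both the parity of m and that of m + 1. *)
Lemma twist_shift_phi_neq e m a :
  twist e (shift m a) <> shift m (bxor a phi).
Proof.
move=> ta; have := congr1 (@^~ 0%N) ta; have := congr1 (@^~ 1%N) ta.
rewrite /twist /shift /bxor /phi addn0 addn1 /=.
by move: (a m) (a m.+1) e (odd m) {ta} => [] [] [] [].
Qed.

(** From left to right, the tail of a after m letters is, up to complement, the
    tail of bxor a phi after n letters, and n differs from m by
    [twist_shift_phi_neq]. The stretch of J M * M at cval a is a product of two
    ratios of [prefix_stretch], both above 1 if m < n and both below 1 if n < m; in
    the second case the inverse of J M plays the role of M. From right to left,
    cval (bxor a phi) and M (cval a) are both expanding fixed points of
    J (J M * M) = M * J M. *)
Lemma fixed_orbit_string a : mixed a -> mixed (bxor a phi) ->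
  (exists M, ract M (cval a) = cval (bxor a phi)) <->
  (exists M, ract (J M * M)%g (cval a) = cval a /\
             1 < stretch (J M * M)%g (cval a)).
Proof.
move=> am bm; have aI := irrational_cval (R:=R) am; have bI := irrational_cval (R:=R) bm.
split=> -[M].
  move=> Mab; have := @dyer_equivariant a (bxor a phi) M am bm bm.
  rewrite bxorK => /(_ am Mab)[n [m [[e tab] sM JM sJM]]].
  have MN : ract (J M * M)%g (cval a) = cval a by rewrite ractM// Mab.
  have sN : stretch (J M * M)%g (cval a) =
      (prefix_stretch n a / prefix_stretch m a) *
      (prefix_stretch n (bxor a phi) / prefix_stretch m (bxor a phi)).
    by rewrite stretchM// Mab sM sJM mulrACA [in RHS]mulrACA [X in _ = _ * X]mulrC.
  case: (ltngtP m n) => [mn|nm|mn]; last first.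
  - by exfalso; apply: (@twist_shift_phi_neq e m a); rewrite tab mn.
  - exists (J M)^-1%g.
    have -> : (J (J M)^-1 * (J M)^-1 = (J M * M)^-1)%g.
      by rewrite (dyerV hJ) (dyerK hJ) invgM.
    have NV : ract (J M * M)^-1%g (cval a) = cval a by rewrite -{1}MN ractK.
    split=> //; rewrite -{1}MN stretchV// sN invfM [X in X * _]invf_div [X in _ * X]invf_div.
    by apply: mulr_egt1; rewrite prefix_stretch_ratio.
  - by exists M; split=> //; rewrite sN; apply: mulr_egt1; rewrite prefix_stretch_ratio.
move=> [MN s1]; exists M.
have := @dyer_equivariant a a (J M * M)%g am am bm bm MN.
move=> [n [m [_ sN JN sJN]]].
have mn : (m < n)%N by rewrite -(@prefix_stretch_ratio m n a)// -sN.
have MI : irrational (ract M (cval a)) by exact: irrational_ract.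
have JMM : ract (J M) (ract M (cval a)) = cval a by rewrite -ractM.
have JNE : J (J M * M)%g = (M * J M)%g by rewrite (dyerM hJ) (dyerK hJ).
apply: (@expanding_fixed_uniq _ (J (J M * M)%g)) => //.
- by rewrite JNE ractM// JMM.
- by rewrite JNE stretchM// JMM mulrC -stretchM.
- by rewrite sJN prefix_stretch_ratio.
Qed.

End Dyer.
End Tails.

(** * Fixed orbits *)

(** J_R extends from the positive to the negative half-line by equivariance under
    x |-> -1 / x, the element UV, whose image under J is V. *)
Lemma JR_string (R : realType) (J : PGL2Z -> PGL2Z) (x : R) :
  dyer_automorphism J -> irrational x -> ~ noble (Some x : Rhat R) ->
  exists g a, [/\ mixed a, mixed (bxor a phi), x = ract g (cval R a) &
                  JR x = Some (ract (J g) (cval R (bxor a phi)))].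
Proof.
move=> hJ xirr nx.
have transfer g a : mixed a -> x = ract g (cval R a) -> mixed (bxor a phi).
  move=> am xE; apply: (@not_noble_mixed R a am) => -[h hE]; apply: nx.
  have phi_irr := irrational_cval (R:=R) mixed_phi.
  exists (g * h)%g; move: hE; rewrite -cval_phi !act_irr// ractM// => -[<-].
  by rewrite xE.
have [x0|x0] := ltP 0 x.
  have [a am xa] := cval_surj xirr x0.
  have xE : x = ract 1%g (cval R a) by rewrite ract1.
  exists 1%g, a; split=> //; first exact: transfer xE.
  rewrite /JR x0 xa kappa_inv_cval// (dyer1 hJ) ract1 kappa_mixed//.
  exact: transfer xE.
have {}x0 : x < 0 by rewrite lt_neqAle irrational_neq0.
have [|a am xa] := @cval_surj R (- x^-1) (irrationalN (irrationalV xirr)).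
  by rewrite oppr_gt0 invr_lt0.
have aI := irrational_cval (R:=R) am.
have xE : x = ract (pglU * pglV)%g (cval R a).
  by rewrite ractM// ractV ractU -xa opprK invrK.
have am' := transfer _ _ am xE.
exists (pglU * pglV)%g, a; split=> //.
have -> : J (pglU * pglV)%g = pglV.
  by case: (hJ) => _ _ JV JU _; rewrite (dyerM hJ) JU JV pglUUK.
rewrite /JR ltNge ltW//= xa kappa_inv_cval//.
have -> : bxor a phi_star = twist true (bxor a phi).
  by apply/funext => k; rewrite /bxor /twist /phi_star /phi addbT addbN.
rewrite kappa_mixed; last exact: mixed_twist.
have y0 := cval_gt0 R am'.
by rewrite cval_complement//= invr_eq0 gt_eqF//= invrK ractV.
Qed.

(** The modulus of an eigenvalue does not change under conjugation. *)
Lemma stretch_conj (R : realType) (g h : PGL2Z) (x : R) : irrational x ->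
  ract h x = x -> 1 < stretch h x ->
  ract (g * h * g^-1)%g (ract g x) = ract g x /\
  1 < stretch (g * h * g^-1)%g (ract g x).
Proof.
move=> xirr hx s1; have gI : irrational (ract g x) by exact: irrational_ract.
rewrite ractM// stretchM// ractK// ractM// stretchM// hx; split=> //.
by rewrite stretchV// mulrAC mulfV ?mul1r// gt_eqF ?stretch_gt0.
Qed.

Lemma mulg_mid (a b c d e : PGL2Z) :
  (a * b * c^-1 * (c * d * e) = a * (b * d) * e)%g.
Proof. by rewrite -!mulgA [(c^-1 * _)%g]mulgA mulVg mul1g. Qed.

Theorem proposition15 (R : realType) (J : PGL2Z -> PGL2Z)
    (hJ : dyer_automorphism J) (x : R) (hirr : irrational x)
    (hnoble : ~ noble (Some x : Rhat R)) :
  (exists M : PGL2Z, JR x = act M (Some x))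
  <->
  (exists M : PGL2Z,
     hyperbolic R (J M * M)%g /\ attracting (J M * M)%g (Some x : Rhat R)).
Proof.
have [g [a [am bm xE JRx]]] := JR_string hJ hirr hnoble.
have aI := irrational_cval (R:=R) am; have bI := irrational_cval (R:=R) bm.
have conjE M h : (J (J h * M * h^-1) * (J h * M * h^-1) = h * (J M * M) * h^-1)%g.
  by rewrite !(dyerM hJ) (dyerK hJ) (dyerV hJ) mulg_mid.
have [fwd bwd] := fixed_orbit_string R hJ am bm.
split=> -[M].
  rewrite JRx act_irr// => -[JRM].
  have [|N [Na s1]] := fwd.
    exists ((J g)^-1 * M * g)%g.
    by rewrite ractM// -xE ractM// -JRM ractK.
  exists (J g * N * g^-1)%g; rewrite conjE.
  have [fx sx] := stretch_conj g aI Na s1.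
  by rewrite xE; apply: expanding_hyperbolic => //; rewrite -xE.
move=> [hyp att].
have sx := attracting_expanding hirr hyp att.
have fx : ract (J M * M)%g x = x.
  by case: att; rewrite /fixed_point act_irr// => -[].
have ax : ract g^-1%g x = cval R a by rewrite xE ractK.
have [fa sa] := stretch_conj g^-1%g hirr fx sx.
have [|N NE] := bwd.
  by exists (J g^-1 * M * g^-1^-1)%g; rewrite conjE -ax.
exists (J g * N * g^-1)%g; rewrite JRx act_irr// ractM// ax ractM//.
by rewrite NE.
Qed.
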